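(* Let $S:U\to Y$ be the solution operator that assigns to $u\in U$ the unique solution $y\in Y$ of $$\mu\int_\Omega \varepsilon y:\varepsilon v\,dx+\nu\int_\Omega \mathsf{m}(\varepsilon y):\varepsilon v\,dx=\int_\Omega u\cdot v\,dx\quad\text{for all }v\in Y.$$ Then $S$ is directionally differentiable, and its directional derivative $S'(u;h)\in Y$ at $u\in U$ in the direction $h\in U$ is the unique solution $z\in Y$ of $$\mu\int_\Omega \varepsilon z:\varepsilon v\,dx+\nu\int_\Omega \mathsf{m}'(\varepsilon y;\varepsilon z):\varepsilon v\,dx=\int_\Omega h\cdot v\,dx\quad\text{for all }v\in Y,$$ where $y=S(u)$.
   Context: $N\in\{2,3\}$; $\Omega\subset\mathbb{R}^N$ is a bounded Lipschitz domain with boundary $\Gamma$; $\mu>0$, $\nu\ge 0$, $g>0$ are constants. $Y=\{y\in H^1(\Omega)^N:\nabla\cdot y=0\text{ in }\Omega,\ y=0\text{ on }\Gamma\}$ with the $H^1$-norm; $U=L^2(\Omega)^N$. $\varepsilon y=\frac12(\nabla y+\nabla y^T)$; $A:B$ is the Frobenius inner product and $|\cdot|$ the Frobenius norm on $\mathbb{R}^{N\times N}$. $\mathsf{m}(E)=\max(0,|E|-g)\frac{E}{|E|}$ for $E\ne0$, $\mathsf{m}(0)=0$. It is known that for each $u\in U$ the equation defining $S(u)$ has a unique solution in $Y$. $\mathsf{m}'(E;H)=\lim_{t\downarrow0}\frac{\mathsf{m}(E+tH)-\mathsf{m}(E)}{t}$ is the directional derivative, explicitly $$\mathsf{m}'(E;H)=\mathbf{1}_{\{|E|>g\}}\Big(H+\frac{gE}{|E|^3}(E:H)-\frac{gH}{|E|}\Big)+\mathbf{1}_{\{|E|=g\}}\max(0,E:H)\frac{E}{g^2},$$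 applied pointwise a.e. in $\Omega$. Directional differentiability of $S$ means that for all $u,h\in U$, $\frac{S(u+th)-S(u)}{t}\to S'(u;h)$ in $Y$ as $t\downarrow0$. *)

(* Defs.v *)
From HB Require Import structures.
From mathcomp Require Import all_boot all_order all_algebra.
From mathcomp Require Import all_classical all_reals all_analysis.

Set Implicit Arguments.
Unset Strict Implicit.
Unset Printing Implicit Defensive.

Import Order.TTheory GRing.Theory Num.Theory.
Import numFieldNormedType.Exports.

Local Open Scope classical_set_scope.
Local Open Scope ring_scope.

(* Matrices carry the product sigma-algebra, generated by the coordinate
   maps; over the reals it is the Borel sigma-algebra. *)
Section measurable_matrix.
Variables (R : realType) (m n : nat).

Definition mx_cylinder : set (set 'M[R]_(m, n)) :=
  [set A | exists i j (B : set R),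
     measurable B /\ A = (fun M : 'M[R]_(m, n) => M i j) @^-1` B].

HB.instance Definition _ := @isMeasurable.Build default_measure_display
  'M[R]_(m, n) <<s mx_cylinder >>
  (@sigma_algebra0 _ setT mx_cylinder) (@sigma_algebraC _ mx_cylinder)
  (@sigma_algebra_bigcup _ setT mx_cylinder).

Lemma measurable_fun_mx d (T : measurableType d) (f : T -> 'M[R]_(m, n)) :
  (forall i j, measurable_fun [set: T] (fun x => f x i j)) ->
  measurable_fun [set: T] f.
Proof.
move=> mf; apply: (@measurability _ _ _ _ _ f mx_cylinder) => //.
move=> _ [_ [i [j [B [mB ->]]]] <-].
exact: (mf i j measurableT B mB).
Qed.

Lemma measurable_mx_coord (i : 'I_m) (j : 'I_n) :
  measurable_fun [set: 'M[R]_(m, n)] (fun M : 'M[R]_(m, n) => M i j).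
Proof.
move=> _ B mB; rewrite setTI; apply: sub_sigma_algebra.
by exists i, j, B.
Qed.

End measurable_matrix.

Section volume.
Variable R : realType.

Definition row_cons n (x : R) (v : 'rV[R]_n) : 'rV[R]_n.+1 :=
  \row_j (if unlift ord0 j is Some k then v 0 k else x).

(* Lebesgue measure on R^n, as the iterated product of the one-dimensional
   Lebesgue measure. *)
Fixpoint volume (n : nat) : set 'rV[R]_n -> \bar R :=
  match n with
  | 0%N => \d_(0 : 'rV[R]_0)
  | k.+1 => fun A =>
      (\int[lebesgue_measure]_x volume [set v : 'rV[R]_k | A (row_cons x v)])%E
  end.

Section volume_step.
Variables (n : nat) (mu : {sigma_finite_measure set 'rV[R]_n -> \bar R}).

Let split (v : 'rV[R]_n.+1) : R * 'rV[R]_n :=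
  (v 0 ord0, \row_j v 0 (lift ord0 j)).

Let join (p : R * 'rV[R]_n) := row_cons p.1 p.2.

Let joinK : cancel join split.
Proof.
case=> x v; rewrite /split /join /row_cons !mxE unlift_none; congr pair.
by apply/rowP => j; rewrite !mxE liftK.
Qed.

Let measurable_join : measurable_fun setT join.
Proof.
apply: measurable_fun_mx => i j; rewrite /join /row_cons.
under eq_fun do rewrite mxE.
case: unlift => [k|]; last exact: measurable_fst.
exact: (measurableT_comp (measurable_mx_coord _ k) measurable_snd).
Qed.

Let measurable_split : measurable_fun setT split.
Proof.
apply/measurable_fun_pairP; split; first exact: measurable_mx_coord.
apply: measurable_fun_mx => i j.
under eq_fun do rewrite mxE.
exact: measurable_mx_coord.
Qed.

Let prod : {measure set (measurableTypeR R * 'rV[R]_n)%type -> \bar R} :=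
  (@lebesgue_measure R \x mu)%E.

Let step (A : set 'rV[R]_n.+1) : \bar R :=
  (\int[lebesgue_measure]_x mu [set v | A (row_cons x v)])%E.

Let stepE A : step A = prod (join @^-1` A).
Proof.
rewrite /step /prod /= /product_measure1; apply: eq_integral => x _ /=.
by congr (mu _); apply/seteqP; split=> v; rewrite /xsection /= inE.
Qed.

Let measurable_preimage_join A : measurable A -> measurable (join @^-1` A).
Proof. by move=> mA; rewrite -[_ @^-1` _]setTI; exact: measurable_join. Qed.

Let step0 : step set0 = 0%E.
Proof. by rewrite stepE preimage_set0 measure0. Qed.

Let step_ge0 A : (0 <= step A)%E.
Proof. by rewrite stepE. Qed.

Let step_sigma_additive : semi_sigma_additive step.
Proof.
move=> F mF tF mUF.
rewrite stepE preimage_bigcup; under eq_fun do under eq_bigr do rewrite stepE.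
apply: measure_semi_sigma_additive.
- by move=> k; exact: measurable_preimage_join.
- apply/trivIsetP => /= i j _ _ ij; rewrite -preimage_setI.
  by move/trivIsetP : tF => /(_ _ _ _ _ ij) ->//; rewrite preimage_set0.
- by rewrite -preimage_bigcup; exact: measurable_preimage_join.
Qed.

HB.instance Definition _ :=
  isMeasure.Build _ _ _ step step0 step_ge0 step_sigma_additive.

Let step_sigma_finite : sigma_finite setT step.
Proof.
have /sigma_finiteP[F [TF ndF Foo]] := sigma_finiteT (@lebesgue_measure R).
have /sigma_finiteP[G [TG ndG Goo]] := sigma_finiteT mu.
exists (fun k => split @^-1` (F k `*` G k)).
  apply/esym; rewrite -subTset => v _.
  have [i _ Fi] : (\bigcup_k F k) (split v).1 by rewrite -TF.
  have [j _ Gj] : (\bigcup_k G k) (split v).2 by rewrite -TG.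
  exists (maxn i j) => //; split.
    by move: Fi; exact/subsetPset/ndF/leq_maxl.
  by move: Gj; exact/subsetPset/ndG/leq_maxr.
move=> k; have [mF Fk] := Foo k; have [mG Gk] := Goo k; split.
  by rewrite -[_ @^-1` _]setTI; apply: measurable_split => //; exact: measurableX.
rewrite stepE (_ : _ @^-1` _ = F k `*` G k); last first.
  by rewrite -comp_preimage (_ : split \o join = id) ?preimage_id//; apply/funext/joinK.
by rewrite /prod/= product_measure1E// lte_mul_pinfty// ge0_fin_numE.
Qed.

HB.instance Definition _ :=
  Measure_isSigmaFinite.Build _ _ _ step step_sigma_finite.

Lemma volume_step :
  exists m : {sigma_finite_measure set 'rV[R]_n.+1 -> \bar R},
    forall A, m A = (\int[lebesgue_measure]_x mu [set v | A (row_cons x v)])%E.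
Proof. by exists step. Qed.

End volume_step.

Lemma volumeP n : exists m : {sigma_finite_measure set 'rV[R]_n -> \bar R},
  @volume n = m.
Proof.
elim: n => [|n [mu muE]].
  by exists (\d_(0 : 'rV[R]_0)).
have [m mE] := volume_step mu.
by exists m; apply/funext => A; rewrite mE /= muE.
Qed.

Section volume_measure.
Variable n : nat.

Let volume0 : @volume n set0 = 0%E.
Proof. by have [m ->] := volumeP n; rewrite measure0. Qed.

Let volume_ge0 A : (0 <= @volume n A)%E.
Proof. by have [m ->] := volumeP n. Qed.

Let volume_sigma_additive : semi_sigma_additive (@volume n).
Proof. by have [m ->] := volumeP n; exact: measure_semi_sigma_additive. Qed.

HB.instance Definition _ := isMeasure.Build _ _ _ (@volume n)
  volume0 volume_ge0 volume_sigma_additive.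

Let volume_sigma_finite : sigma_finite setT (@volume n).
Proof. by have [m ->] := volumeP n; exact: sigma_finiteT. Qed.

HB.instance Definition _ :=
  Measure_isSigmaFinite.Build _ _ _ (@volume n) volume_sigma_finite.

End volume_measure.

End volume.


Arguments volume {R n} A.

Section tensors.
Variable R : realType.

(* Frobenius inner product; on row vectors it is the dot product. The library
   norm `|A| on matrices is the max-norm, hence the separate frob_norm. *)
Definition frob m n (A B : 'M[R]_(m, n)) : R :=
  \sum_(i < m) \sum_(j < n) A i j * B i j.

Definition frob_norm m n (A : 'M[R]_(m, n)) : R := Num.sqrt (frob A A).

Definition sym_part n (A : 'M[R]_n) : 'M[R]_n := 2^-1 *: (A + A^T).

Definition plast (g : R) n (E : 'M[R]_n) : 'M[R]_n :=
  if E == 0 then 0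
  else (Num.max 0 (frob_norm E - g) / frob_norm E) *: E.

Definition plast' (g : R) n (E H : 'M[R]_n) : 'M[R]_n :=
  lim (t^-1 *: (plast g (E + t *: H) - plast g E) @[t --> 0^'+]).

End tensors.

Section spaces.
Variables (R : realType) (N : nat).
Implicit Types (Omega : set 'rV[R]_N) (phi : 'rV[R]_N -> R).

(* Near each boundary point, in suitable orthonormal coordinates, Omega is the
   region strictly above the graph of a Lipschitz function of the other N - 1
   coordinates. *)
Definition lipschitz_boundary Omega : Prop :=
  forall x0, closure Omega x0 -> ~ interior Omega x0 ->
  exists (Q : 'M[R]_N) (j : 'I_N) (gamma : 'rV[R]_N.-1 -> R) (k : R),
    [/\ Q *m Q^T = 1%:M, k.-lipschitz gamma &
        \forall x \near x0,
          Omega x <-> gamma (col' j (x *m Q)) < (x *m Q) 0 j].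

Definition bounded_lipschitz_domain Omega : Prop :=
  [/\ open Omega, connected Omega, Omega !=set0, bounded_set Omega &
      lipschitz_boundary Omega].

Definition partial (j : 'I_N) (phi : 'rV[R]_N -> R) : 'rV[R]_N -> R :=
  'D_(delta_mx 0 j : 'rV[R]_N) phi.

Definition smooth phi : Prop :=
  forall (s : seq 'I_N) (x : 'rV[R]_N), differentiable (foldr partial phi s) x.

Definition test_function Omega phi : Prop :=
  [/\ smooth phi, compact (closure [set x | phi x != 0]) &
      closure [set x | phi x != 0] `<=` Omega].

Definition jacobian_field (f : 'rV[R]_N -> 'rV[R]_N) (x : 'rV[R]_N) : 'M[R]_N :=
  \matrix_(i < N, j < N) partial j (fun z => f z 0 i) x.

Definition square_integrable Omega m n (F : 'rV[R]_N -> 'M[R]_(m, n)) : Prop :=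
  measurable_fun Omega F /\
  (\int[volume]_(x in Omega) (frob (F x) (F x))%:E < +oo)%E.

(* The H^1(Omega)^N-norm of a vector field f with weak gradient G. *)
Definition H1_norm Omega (f : 'rV[R]_N -> 'rV[R]_N) (G : 'rV[R]_N -> 'M[R]_N)
    : \bar R :=
  sqrte (\int[volume]_(x in Omega)
           (frob (f x) (f x) + frob (G x) (G x))%:E)%E.

(* An element of H^1(Omega)^N is a representative together with a
   representative of its weak gradient, grad x i j being the j-th partial
   derivative of the i-th component. Values outside Omega are irrelevant, and
   elements are to be compared by H1_eq. *)
Record H1 Omega := {
  fld :> 'rV[R]_N -> 'rV[R]_N;
  grad : 'rV[R]_N -> 'M[R]_N;
  fld_sqint : square_integrable Omega fld;
  grad_sqint : square_integrable Omega grad;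
  grad_weak : forall phi, test_function Omega phi -> forall i j : 'I_N,
        \int[volume]_(x in Omega) (fld x 0 i * partial j phi x) =
        - \int[volume]_(x in Omega) (grad x i j * phi x) }.

Definition H1_eq Omega (y z : H1 Omega) : Prop :=
  {ae volume, forall x, Omega x -> y x = z x /\ grad y x = grad z x}.

(* y = 0 on the boundary: y is an H^1-limit of smooth fields with compact
   support in Omega. *)
Definition vanishes_on_boundary Omega (y : H1 Omega) : Prop :=
  exists phi : nat -> 'rV[R]_N -> 'rV[R]_N,
    (forall k (i : 'I_N), test_function Omega (fun x => phi k x 0 i)) /\
    H1_norm Omega (fun x => phi k x - y x)
                  (fun x => jacobian_field (phi k) x - grad y x)
      @[k --> \oo] --> 0%E.

Record Y Omega := {
  Y_H1 :> H1 Omega;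
  Y_divfree : {ae volume, forall x, Omega x -> \tr (grad Y_H1 x) = 0};
  Y_boundary : vanishes_on_boundary Y_H1 }.

Definition strain Omega (y : H1 Omega) (x : 'rV[R]_N) : 'M[R]_N :=
  sym_part (grad y x).

Definition state_equation Omega (mu nu g : R) (u : 'rV[R]_N -> 'rV[R]_N)
    (y : Y Omega) : Prop :=
  forall v : Y Omega,
    mu * \int[volume]_(x in Omega) frob (strain y x) (strain v x) +
    nu * \int[volume]_(x in Omega) frob (plast g (strain y x)) (strain v x) =
    \int[volume]_(x in Omega) frob (u x) (v x).

Definition linearized_equation Omega (mu nu g : R) (y : Y Omega)
    (h : 'rV[R]_N -> 'rV[R]_N) (z : Y Omega) : Prop :=
  forall v : Y Omega,
    mu * \int[volume]_(x in Omega) frob (strain z x) (strain v x) +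
    nu * \int[volume]_(x in Omega)
           frob (plast' g (strain y x) (strain z x)) (strain v x) =
    \int[volume]_(x in Omega) frob (h x) (v x).

(* The one-sided difference quotients (S (u + t h) - S u) / t converge to z in
   the H^1-norm as t decreases to 0. *)
Definition directional_derivative Omega
    (S : ('rV[R]_N -> 'rV[R]_N) -> Y Omega) (u h : 'rV[R]_N -> 'rV[R]_N)
    (z : Y Omega) : Prop :=
  let Sut t := S (fun x => u x + t *: h x) in
  H1_norm Omega (fun x => t^-1 *: (Sut t x - S u x) - z x)
                (fun x => t^-1 *: (grad (Sut t) x - grad (S u) x) - grad z x)
    @[t --> (0 : R)^'+] --> 0%E.

End spaces.

(* Main.v *)
Require Import Defs.
From HB Require Import structures.
From mathcomp Require Import all_boot all_order all_algebra.
From mathcomp Require Import all_classical all_reals all_analysis.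
From mathcomp Require Import measurable_realfun.
From mathcomp Require Import ring lra.

Set Implicit Arguments.
Unset Strict Implicit.
Unset Printing Implicit Defensive.

Import Order.TTheory GRing.Theory Num.Theory.
Import numFieldNormedType.Exports.

Local Open Scope classical_set_scope.
Local Open Scope ring_scope.

(* The derivative [z] is obtained as the minimizer over [Y] of
     J z = mu/2 |eps z|^2 + nu/2 int m'(eps y; eps z) : eps z - int h . z,
   whose integrand is squeezed between quadratics: this makes minimizing
   sequences Cauchy and yields the linearized equation as Euler-Lagrange equation.
   Solenoidal fields satisfy |grad y|^2 = 2 |eps y|^2 and a Poincare inequality,
   so that convergence of strains is H^1-convergence. With
   q_t H = (m (eps y + t H) - m (eps y)) / t, which is monotone in [H], testing the
   difference of the equations of z_t = (S (u + t h) - S u) / t and of [z] with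
   z_t - z gives mu |eps (z_t - z)| <= nu |q_t (eps z) - m' (eps y; eps z)|, and
   the right-hand side tends to 0 by dominated convergence. *)

(** * Frobenius product and the plasticity law *)

(** Where [|eps y| = g], the map [m'(eps y; .)] is positively homogeneous but in general not linear,
    so the linearized equation need not be a linear problem. It is still the gradient of the convex
    function [H |-> m'(E; H) : H / 2], and this is what gives it a variational form. The bounds on
    [q_t] rest on one fact: [m] is the identity minus the projection onto the ball of radius [g],
    hence firmly nonexpansive. These bounds pass to [m'] in the limit and supply the majorant for
    dominated convergence. Since the monotone comparison is made at the fixed direction [eps z],
    neither weak compactness nor an a priori bound on [z_t] enters. Zero boundary values mean
    approximability by smooth compactly supported fields, so both inequalities for solenoidal fields
    are obtained by integrating by parts against test functions and passing to the limit in
    [L^2]. *)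

Section frobenius.
Variable R : realType.

Lemma frobC m n (A B : 'M[R]_(m, n)) : frob A B = frob B A.
Proof. by apply: eq_bigr => i _; apply: eq_bigr => j _; rewrite mulrC. Qed.

Lemma frobDl m n (A B C : 'M[R]_(m, n)) : frob (A + B) C = frob A C + frob B C.
Proof.
rewrite -big_split; apply: eq_bigr => i _; rewrite -big_split.
by apply: eq_bigr => j _; rewrite mxE mulrDl.
Qed.

Lemma frobZl m n a (A B : 'M[R]_(m, n)) : frob (a *: A) B = a * frob A B.
Proof.
rewrite mulr_sumr; apply: eq_bigr => i _; rewrite mulr_sumr.
by apply: eq_bigr => j _; rewrite mxE mulrA.
Qed.

Lemma frobDr m n (A B C : 'M[R]_(m, n)) : frob A (B + C) = frob A B + frob A C.
Proof. by rewrite frobC frobDl !(frobC A). Qed.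

Lemma frobZr m n a (A B : 'M[R]_(m, n)) : frob A (a *: B) = a * frob A B.
Proof. by rewrite frobC frobZl frobC. Qed.

Lemma frobNl m n (A B : 'M[R]_(m, n)) : frob (- A) B = - frob A B.
Proof. by rewrite -scaleN1r frobZl mulN1r. Qed.

Lemma frobNr m n (A B : 'M[R]_(m, n)) : frob A (- B) = - frob A B.
Proof. by rewrite frobC frobNl frobC. Qed.

Definition frobE := (frobDl, frobDr, frobNl, frobNr, frobZl, frobZr).

Lemma frob0l m n (B : 'M[R]_(m, n)) : frob 0 B = 0.
Proof. by rewrite -(scale0r B) frobZl mul0r. Qed.

Lemma frob_ge0 m n (A : 'M[R]_(m, n)) : 0 <= frob A A.
Proof.
by apply: sumr_ge0 => i _; apply: sumr_ge0 => j _; rewrite -expr2 sqr_ge0.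
Qed.

Lemma frob_coord_le m n (A : 'M[R]_(m, n)) i j : A i j ^+ 2 <= frob A A.
Proof.
rewrite /frob (bigD1 i)//= (bigD1 j)//= expr2 -addrA lerDl addr_ge0//.
  by apply: sumr_ge0 => l _; rewrite -expr2 sqr_ge0.
by apply: sumr_ge0 => l _; apply: sumr_ge0 => k _; rewrite -expr2 sqr_ge0.
Qed.

Lemma frob_eq0 m n (A : 'M[R]_(m, n)) : (frob A A == 0) = (A == 0).
Proof.
apply/eqP/eqP => [A0|->]; last by rewrite frob0l.
apply/matrixP => i j; rewrite mxE; apply/eqP.
by rewrite -sqrf_eq0 eq_le sqr_ge0 andbT -A0 frob_coord_le.
Qed.

Lemma frob_tr m n (A B : 'M[R]_(m, n)) : frob A^T B^T = frob A B.
Proof.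
rewrite /frob exchange_big; apply: eq_bigr => i _; apply: eq_bigr => j _.
by rewrite !mxE.
Qed.

Lemma frob_sym_part n (A : 'M[R]_n) :
  frob (sym_part A) (sym_part A) = 2^-1 * (frob A A + frob A A^T).
Proof. by rewrite /sym_part !frobE frob_tr (frobC A^T); field. Qed.

Lemma sqr_frob_norm m n (A : 'M[R]_(m, n)) : frob_norm A ^+ 2 = frob A A.
Proof. exact/sqr_sqrtr/frob_ge0. Qed.

Lemma frob_norm_ge0 m n (A : 'M[R]_(m, n)) : 0 <= frob_norm A.
Proof. exact: sqrtr_ge0. Qed.

Lemma frob_CS m n (A B : 'M[R]_(m, n)) : frob A B ^+ 2 <= frob A A * frob B B.
Proof.
have [->|B0] := eqVneq B 0; first by rewrite frobC !frob0l expr0n mulr0.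
have BB : 0 < frob B B by rewrite lt_neqAle eq_sym frob_eq0 B0 frob_ge0.
have := frob_ge0 (frob B B *: A - frob A B *: B).
rewrite !frobE (frobC B A) => H; rewrite -subr_ge0 -(pmulr_rge0 _ BB).
by apply: le_trans H _; rewrite le_eqVlt; apply/orP; left; apply/eqP; ring.
Qed.

Lemma frob_le_norm m n (A B : 'M[R]_(m, n)) :
  frob A B <= frob_norm A * frob_norm B.
Proof.
apply: le_trans (ler_norm _) _; rewrite -sqrtr_sqr /frob_norm -sqrtrM ?frob_ge0//.
by rewrite ler_wsqrtr// frob_CS.
Qed.

Lemma frob_young m n (A B : 'M[R]_(m, n)) :
  `|frob A B| <= frob A A + frob B B.
Proof.
have := frob_ge0 (A + B); have := frob_ge0 (A - B).
have := frob_ge0 A; have := frob_ge0 B.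
rewrite !frobE (frobC B A) ler_norml; lra.
Qed.

Lemma frobD_le m n (A B : 'M[R]_(m, n)) :
  frob (A + B) (A + B) <= 2 * frob A A + 2 * frob B B.
Proof. by have := frob_ge0 (A - B); rewrite !frobE (frobC B A); lra. Qed.

Lemma frobB_le m n (A B : 'M[R]_(m, n)) :
  frob (A - B) (A - B) <= 2 * frob A A + 2 * frob B B.
Proof. by have := frob_ge0 (A + B); rewrite !frobE (frobC B A); lra. Qed.

End frobenius.

Section convergence.
Context (R : realType) (T : Type) (F : set_system T) {FF : Filter F}.

Lemma cvg_max0 (f : T -> R) (a : R) :
  f @ F --> a -> Num.max 0 (f x) @[x --> F] --> Num.max 0 a.
Proof.
move=> fa; rewrite maxr_absE; under eq_fun do rewrite maxr_absE.
apply: cvgM; last exact: cvg_cst.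
apply: cvgD; first by apply: cvgD => //; exact: cvg_cst.
by apply: cvg_norm; apply: cvgB => //; exact: cvg_cst.
Qed.

Lemma cvg_coord m n (f : T -> 'M[R]_(m, n)) (a : 'M[R]_(m, n)) i j :
  f @ F --> a -> f x i j @[x --> F] --> a i j.
Proof.
by move=> fa; apply: (cvg_comp f (fun M : 'M[R]_(m, n) => M i j) fa); exact: coord_continuous.
Qed.

Lemma cvg_frob m n (f g : T -> 'M[R]_(m, n)) (a b : 'M[R]_(m, n)) :
  f @ F --> a -> g @ F --> b -> frob (f x) (g x) @[x --> F] --> frob a b.
Proof.
move=> fa gb; apply: cvg_big => [|i _]; first exact: add_continuous.
apply: cvg_big => [|j _]; first exact: add_continuous.
by apply: cvgM; apply: cvg_coord.
Qed.

End convergence.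

(** * The plasticity law, its directional derivative and its potential *)

Section plasticity.
Variables (R : realType) (g : R) (n : nat).
Hypothesis g_gt0 : 0 < g.
Implicit Types A B E H V : 'M[R]_n.

(** At [E = 0] the quotient is [0] by the convention for division by zero, so [alpha E *: E]
    represents the law without a case distinction. *)
Let alpha E : R := Num.max 0 (frob_norm E - g) / frob_norm E.

Lemma plastE E : plast g E = alpha E *: E.
Proof. by rewrite /plast; case: eqVneq => [->|//]; rewrite scaler0. Qed.

Let alpha_small E : frob_norm E <= g -> alpha E = 0.
Proof. by move=> Eg; rewrite /alpha max_l ?mul0r// subr_le0. Qed.

Let alpha_large E : g <= frob_norm E -> alpha E = 1 - g / frob_norm E.
Proof.
move=> Eg; rewrite /alpha max_r ?subr_ge0// mulrBl divff//.
by rewrite lt0r_neq0// (lt_le_trans g_gt0).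
Qed.

Let alpha_ge0 E : 0 <= alpha E.
Proof. by rewrite /alpha divr_ge0 ?frob_norm_ge0// le_max lexx. Qed.

Let alpha_le1 E : alpha E <= 1.
Proof.
have [Eg|/ltW Eg] := leP (frob_norm E) g; first by rewrite alpha_small.
by rewrite alpha_large// gerBl divr_ge0 ?frob_norm_ge0// ltW.
Qed.

(** This is [plast g E : (P - (E - plast g E)) <= 0], the variational inequality that characterizes
    the projection of [E] onto the closed ball of radius [g]. *)
Let plast_variational E P : frob_norm P <= g ->
  frob (plast g E) P <= frob (plast g E) (E - plast g E).
Proof.
move=> Pg; rewrite plastE.
have [Eg|/ltW Eg] := leP (frob_norm E) g; first by rewrite alpha_small// scale0r !frob0l.
have E0 : frob_norm E != 0 by rewrite lt0r_neq0// (lt_le_trans g_gt0).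
rewrite (_ : E - _ = (1 - alpha E) *: E); last by rewrite scalerBl scale1r.
rewrite !frobZl frobZr; apply: ler_wpM2l => //.
apply: le_trans (frob_le_norm _ _) _.
rewrite alpha_large// opprB addrC subrK -sqr_frob_norm expr2 mulrA divfK// mulrC.
by rewrite ler_wpM2r// frob_norm_ge0.
Qed.

Let plast_residual E : frob_norm (E - plast g E) <= g.
Proof.
rewrite plastE; have [Eg|/ltW Eg] := leP (frob_norm E) g.
  by rewrite alpha_small// scale0r subr0.
have E0 : frob_norm E != 0 by rewrite lt0r_neq0// (lt_le_trans g_gt0).
rewrite (_ : E - _ = (1 - alpha E) *: E); last by rewrite scalerBl scale1r.
rewrite alpha_large// opprB addrC subrK.
rewrite {1}/frob_norm frobZl frobZr -sqr_frob_norm mulrA -expr2 -exprMn divfK//.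
by rewrite sqrtr_sqr ger0_norm// ltW.
Qed.

(* [A - plast g A] is the projection of [A] onto the ball of radius [g]. *)
Lemma plast_firm A B :
  frob (plast g A - plast g B) (plast g A - plast g B) <=
  frob (plast g A - plast g B) (A - B).
Proof.
have := plast_variational A (plast_residual B).
have := plast_variational B (plast_residual A).
rewrite !frobE (frobC (plast g B) (plast g A)); lra.
Qed.

(** With [M] the difference of the values and [D] that of the arguments, [|D - M|^2 >= 0] and
    [|M|^2 <= M : D] give [|M|^2 <= 2 M : D - |M|^2 <= |D|^2]. *)
Lemma plast_lipschitz A B :
  frob (plast g A - plast g B) (plast g A - plast g B) <= frob (A - B) (A - B).
Proof.
have := plast_firm A B; have := frob_ge0 (A - B - (plast g A - plast g B)).
move: (A - B) (plast g A - plast g B) => D M.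
rewrite !frobE (frobC D M); lra.
Qed.

Lemma plast0 : plast g 0 = 0 :> 'M[R]_n.
Proof. by rewrite plastE scaler0. Qed.

(* For [|E| = g] the coefficient [g / |E|^3] is the [1 / g^2] of the usual formula. *)
Definition dplast E H : 'M[R]_n :=
  let K := g / frob_norm E ^+ 3 in
  alpha E *: H
  + (if g < frob_norm E then K * frob E H
     else if frob_norm E == g then K * Num.max 0 (frob E H) else 0) *: E.

(** As [dplast E] is positively homogeneous of degree one, Euler's identity dictates this form for
    the potential whose gradient it is. *)
Definition dplast_energy E H : R := 2^-1 * frob (dplast E H) H.

Lemma cvg_frob_norm E H :
  frob_norm (E + t *: H) @[t --> (0 : R)^'+] --> frob_norm E.
Proof.
have -> : (fun t => frob_norm (E + t *: H)) =
    Num.sqrt \o (fun t => frob E E + t * (2 * frob E H + t * frob H H)).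
  by apply/funext => t /=; congr Num.sqrt; rewrite !frobE (frobC H E); ring.
have -> : frob_norm E = Num.sqrt (frob E E + 0 * (2 * frob E H + 0 * frob H H)).
  by rewrite mul0r addr0.
apply: continuous_cvg; first exact: sqrt_continuous.
apply: cvgD; first exact: cvg_cst.
have c0 : (t @[t --> (0:R)^'+] --> (0:R)) by apply: cvg_at_right_filter; exact: cvg_id.
apply: cvgM => //; apply: cvgD; first exact: cvg_cst.
by apply: cvgM => //; exact: cvg_cst.
Qed.

(** Rationalizing the difference of the inverse norms produces [|E + t H|^2 - |E|^2], from which a
    factor [t] cancels exactly; no derivative of the square root is taken. *)
Let quotient E H (t : R) : 0 < t -> 0 < frob_norm E -> 0 < frob_norm (E + t *: H) ->
  t^-1 * ((1 - g / frob_norm (E + t *: H)) - (1 - g / frob_norm E)) =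
  g * (2 * frob E H + t * frob H H) /
  (frob_norm (E + t *: H) * frob_norm E * (frob_norm (E + t *: H) + frob_norm E)).
Proof.
move=> t0 r0 rt.
have e : frob_norm (E + t *: H) ^+ 2 =
    frob_norm E ^+ 2 + t * (2 * frob E H + t * frob H H).
  by rewrite !sqr_frob_norm !frobE (frobC H E); ring.
have e2 : (2 * frob E H + t * frob H H) =
    t^-1 * (frob_norm (E + t *: H) ^+ 2 - frob_norm E ^+ 2).
  by rewrite e; field; exact: lt0r_neq0.
rewrite e2; field; rewrite !lt0r_neq0//; exact: addr_gt0.
Qed.

Let cvg_quotient E H : 0 < frob_norm E ->
  g * (2 * frob E H + t * frob H H) /
  (frob_norm (E + t *: H) * frob_norm E * (frob_norm (E + t *: H) + frob_norm E))
  @[t --> (0:R)^'+] --> g / frob_norm E ^+ 3 * frob E H.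
Proof.
move=> r0.
have c0 : (t @[t --> (0:R)^'+] --> (0:R)) by apply: cvg_at_right_filter; exact: cvg_id.
have -> : g / frob_norm E ^+ 3 * frob E H =
  g * (2 * frob E H + 0 * frob H H) /
  (frob_norm E * frob_norm E * (frob_norm E + frob_norm E)).
  by rewrite mul0r addr0; field; rewrite !lt0r_neq0// addr_gt0.
have cr := @cvg_frob_norm E H.
apply: cvgM.
  apply: cvgM; first exact: cvg_cst.
  by apply: cvgD; [exact: cvg_cst|apply: cvgM => //; exact: cvg_cst].
apply: cvgV; first by rewrite lt0r_neq0// !mulr_gt0// addr_gt0.
apply: cvgM; first by apply: cvgM => //; exact: cvg_cst.
by apply: cvgD => //; exact: cvg_cst.
Qed.

Lemma cvg_plast_quotient E H :
  t^-1 *: (plast g (E + t *: H) - plast g E) @[t --> 0^'+] --> dplast E H.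
Proof.
have cr := @cvg_frob_norm E H.
have ca : alpha (E + t *: H) @[t --> 0^'+] --> alpha E.
  have [Eg|Eg] := ltP (frob_norm E) g.
    rewrite (alpha_small (ltW Eg)); apply: cvg_near_cst.
    near=> t; apply: alpha_small; apply: ltW.
    by near: t; apply: cvgr_lt cr _ Eg.
  apply: cvgM; last by apply: cvgV => //; rewrite lt0r_neq0// (lt_le_trans g_gt0).
  apply: cvg_max0.
  by apply: cvgB => //; exact: cvg_cst.
(* By the discrete product rule for [alpha E *: E], only the difference quotient of the scalar
   [alpha] remains to be treated. *)
suff cq : t^-1 * (alpha (E + t *: H) - alpha E) @[t --> 0^'+] -->
   (if g < frob_norm E then g / frob_norm E ^+ 3 * frob E H
     else if frob_norm E == g then g / frob_norm E ^+ 3 * Num.max 0 (frob E H) else 0).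
  rewrite /dplast.
  apply: (@cvg_trans _ ((alpha (E + t *: H) *: H +
      (t^-1 * (alpha (E + t *: H) - alpha E)) *: E) @[t --> 0^'+])).
    apply: near_eq_cvg; near=> t; rewrite !plastE.
    have t0 : t != 0 by rewrite lt0r_neq0//; near: t; exact: nbhs_right_gt.
    by apply/matrixP => i j; rewrite !mxE; field.
  by apply: cvgD; apply: cvgZ => //; exact: cvg_cst.
case: ltgtP => Eg.
- have r0 : 0 < frob_norm E by rewrite (lt_trans g_gt0).
  apply: (@cvg_trans _ ((g * (2 * frob E H + t * frob H H) /
    (frob_norm (E + t *: H) * frob_norm E *
     (frob_norm (E + t *: H) + frob_norm E))) @[t --> (0:R)^'+])); last first.
    exact: cvg_quotient.
  apply: near_eq_cvg; near=> t.
  have rt : g < frob_norm (E + t *: H) by near: t; apply: cvgr_gt cr _ Eg.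
  have t0 : 0 < t by near: t; exact: nbhs_right_gt.
  by rewrite -quotient ?(lt_trans g_gt0 rt)// !alpha_large// ltW.
- apply: cvg_near_cst; near=> t.
  by rewrite !alpha_small ?subrr ?mulr0 ?(ltW Eg)//; apply: ltW; near: t; apply: cvgr_lt cr _ Eg.
(* On the kink [alpha E = 0], while [alpha (E + t *: H)] is the positive part of the smooth
   expression used for [|E| > g]. Positive factors move through [max], which is continuous, so the
   limit is the positive part of the smooth one. *)
- have r0 : 0 < frob_norm E by rewrite -Eg.
  have K0 : 0 <= g / frob_norm E ^+ 3 by rewrite divr_ge0 ?exprn_ge0 ?ltW.
  rewrite maxr_pMr// mulr0.
  apply: (@cvg_trans _ (Num.max 0 (g * (2 * frob E H + t * frob H H) /
    (frob_norm (E + t *: H) * frob_norm E *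
     (frob_norm (E + t *: H) + frob_norm E))) @[t --> (0:R)^'+])); last first.
    by apply: cvg_max0; exact: cvg_quotient.
  apply: near_eq_cvg; near=> t.
  have t0 : 0 < t by near: t; exact: nbhs_right_gt.
  have rt : 0 < frob_norm (E + t *: H) by near: t; apply: cvgr_gt cr _ r0.
  rewrite -quotient// -Eg divff ?lt0r_neq0// subrr subr0.
  rewrite -[X in Num.max X _](mulr0 t^-1) -maxr_pMr ?invr_ge0 ?ltW//.
  rewrite (alpha_small (E := E)) -?Eg// subr0 /alpha; congr (_ * _).
  rewrite (_ : 1 - _ = (frob_norm (E + t *: H) - g) / frob_norm (E + t *: H)).
    by rewrite maxr_pMl ?mul0r// invr_ge0 ltW.
  by field; exact: lt0r_neq0.
Unshelve. all: by end_near. Qed.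

Lemma plast'E E H : plast' g E H = dplast E H.
Proof. by apply: cvg_lim => //; exact: cvg_plast_quotient. Qed.

(** The terms [plast g E] cancel and [H1 - H2] is [1 / t] times the difference of the arguments, so
    [plast_firm] applies. *)
Lemma plast_quotient_monotone E H1 H2 (t : R) : 0 < t ->
  0 <= frob (t^-1 *: (plast g (E + t *: H1) - plast g E) -
             t^-1 *: (plast g (E + t *: H2) - plast g E)) (H1 - H2).
Proof.
move=> t0; rewrite -scalerBr opprB addrA subrK.
have -> : H1 - H2 = t^-1 *: ((E + t *: H1) - (E + t *: H2)).
  by apply/matrixP => i j; rewrite !mxE; field; exact: lt0r_neq0.
rewrite frobZl frobZr mulrA mulr_ge0//; first by rewrite mulr_ge0 ?invr_ge0 ?ltW.
exact: le_trans (frob_ge0 _) (plast_firm _ _).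
Qed.

(** The bound is uniform in [t], which makes [|H|^2] a majorant for the limit [t -> 0]. *)
Lemma plast_quotient_le E H (t : R) : 0 < t ->
  frob (t^-1 *: (plast g (E + t *: H) - plast g E))
       (t^-1 *: (plast g (E + t *: H) - plast g E)) <= frob H H.
Proof.
move=> t0; rewrite frobZl frobZr.
have := plast_lipschitz (E + t *: H) E.
rewrite [E + _]addrC addrK frobZl frobZr => le.
rewrite mulrA -(ler_pM2l (mulr_gt0 t0 t0)) mulrA.
by rewrite (_ : t * t * _ = 1) ?mul1r ?mulrA// in le *; field; exact: lt0r_neq0.
Qed.

(** First-order expansion of [s |-> max(0, s)^2], which is convex and has the 2-Lipschitz derivative
    [2 max(0, s)]. *)
Let maxr_sqr_expansion (a b : R) :
  0 <= Num.max 0 (a + b) * (a + b) - Num.max 0 a * a - 2 * (Num.max 0 a * b) <= b ^+ 2.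
Proof. by case: (leP 0 a) => ?; case: (leP 0 (a + b)) => ?; apply/andP; split; nra. Qed.

(** The lower bound is convexity; the upper one says that the energy is at most quadratic above its
    tangent. The [alpha] term and the [E : V] term each contribute at most [|V|^2 / 2], the second
    because [g / |E|^3 * (E : V)^2 <= (g / |E|) |V|^2]; the constant [3 / 2] leaves room. *)
Lemma dplast_energy_expansion E H V :
  0 <= dplast_energy E (H + V) - dplast_energy E H - frob (dplast E H) V
    <= 3 / 2 * frob V V.
Proof.
have V0 := frob_ge0 V; have a0 := alpha_ge0 E; have a1 := alpha_le1 E.
have aV : 0 <= alpha E * frob V V <= frob V V.
  by rewrite mulr_ge0//= ler_piMl.
have KV : g <= frob_norm E ->
    0 <= g / frob_norm E ^+ 3 * frob E V ^+ 2 <= frob V V.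
  move=> Eg; have E0 : 0 < frob_norm E by rewrite (lt_le_trans g_gt0).
  have K0 : 0 <= g / frob_norm E ^+ 3 by rewrite divr_ge0 ?exprn_ge0 ?ltW.
  rewrite mulr_ge0 ?sqr_ge0//=.
  apply: (@le_trans _ _ (g / frob_norm E ^+ 3 * (frob E E * frob V V))).
    by rewrite ler_wpM2l ?frob_CS.
  rewrite -sqr_frob_norm mulrA.
  rewrite (_ : g / _ * _ = g / frob_norm E); last by field; exact: lt0r_neq0.
  by rewrite ler_piMl// ler_pdivrMr// mul1r.
rewrite /dplast_energy /dplast !frobE (frobC V H).
case: (ltgtP g (frob_norm E)) => Eg.
- have := KV (ltW Eg); move: (g / _) => K.
  by move=> /andP[? ?]; move/andP: aV => [? ?]; apply/andP; split; nra.
- by move/andP: aV => [? ?]; apply/andP; split; nra.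
- have K0 : 0 <= g / frob_norm E ^+ 3 by rewrite divr_ge0 ?exprn_ge0 ?frob_norm_ge0 ?ltW.
  have := KV; rewrite {1}Eg lexx => /(_ isT).
  move: (g / _) K0 => K K0 /andP[K1 K2]; move/andP: aV => [? ?].
  have /andP[M1 M2] := maxr_sqr_expansion (frob E H) (frob E V).
  have := mulr_ge0 K0 M1; have := ler_wpM2l K0 M2 => ? ?.
  by apply/andP; split; lra.
Qed.

Lemma dplast0 E : dplast E 0 = 0.
Proof.
by rewrite /dplast scaler0 add0r frobC frob0l maxxx mulr0 !if_same scale0r.
Qed.

End plasticity.

(** The uniform bound on the difference quotients passes to their limit. *)
Lemma frob_dplast_le (R : realType) (g : R) n (E H : 'M[R]_n) : 0 < g ->
  frob (dplast g E H) (dplast g E H) <= frob H H.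
Proof.
move=> g0; have cq := @cvg_plast_quotient R g n g0 E H.
apply: (cvgr_to_le (cvg_frob cq cq)); near=> t; apply: plast_quotient_le => //.
Unshelve. all: by end_near. Qed.

(** * Square-integrable fields *)

Section L2_complete.
Context d (T : measurableType d) (R : realType).
Variables (mu : {measure set T -> \bar R}) (D : set T).
Hypothesis mD : measurable D.
Implicit Types f g : T -> R.

Let sqdist f g := (\int[mu]_(x in D) ((f x - g x) ^+ 2)%:E)%E.

Let measurable_sqdist f g : measurable_fun D f -> measurable_fun D g ->
  measurable_fun D (EFin \o (fun x => (f x - g x) ^+ 2)).
Proof.
by move=> mf mg; apply/measurable_EFinP; apply: measurable_funX; exact: measurable_funB.
Qed.

Let fast_subsequence (P : nat -> nat -> Prop) :
  (forall k, exists M, forall n, (M <= n)%N -> P k n) ->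
  exists s : nat -> nat, forall k, [/\ (k <= s k)%N, (s k <= s k.+1)%N & P k (s k)].
Proof.
(* Partial sums of [(M i).+1] are increasing, exceed their index and dominate each [M i]. *)
move=> /choice[M MP]; exists (fun j => \sum_(i < j.+1) (M i).+1)%N => k; split.
- rewrite big_ord_recr /= -[leqLHS]addn0 leq_add// -[leqLHS]muln1.
  by rewrite -[k in leqLHS]card_ord -sum_nat_const leq_sum.
- by rewrite [leqRHS]big_ord_recr /= leq_addr.
- apply: MP; rewrite big_ord_recr/=.
  by rewrite (leq_trans (leqnSn _))// leq_addl.
Qed.

(** The increments are at most [sqrt C * 2^-k], so the telescoping series is dominated by a
    geometric one. *)
Let cvg_fast (u : nat -> R) (C : R) :
  (forall k, 4 ^+ k * (u k.+1 - u k) ^+ 2 <= C) -> cvgn u.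
Proof.
move=> uC; have C0 : 0 <= C by rewrite (le_trans _ (uC 0%N))// mulr_ge0 ?sqr_ge0.
have -> : u = (fun n => u 0%N + series (telescope u) n).
  by apply/funext => n; rewrite -eq_sum_telescope.
apply: is_cvgD; first exact: is_cvg_cst.
apply: normed_cvg; apply: (@series_le_cvg _ _ (geometric (Num.sqrt C) 2^-1)).
- by move=> n /=.
- by move=> n; rewrite mulr_ge0 ?sqrtr_ge0 ?exprn_ge0.
- move=> n; rewrite /telescope /= -ler_pdivrMr ?exprn_gt0// -exprVn invrK.
  rewrite -[leLHS]ger0_norm ?mulr_ge0 ?exprn_ge0// -sqrtr_sqr ler_wsqrtr//.
  rewrite exprMn -normrX ger0_norm ?sqr_ge0// mulrC -exprM mulnC exprM.
  by rewrite (_ : 2 ^+ 2 = 4 :> R) ?uC// expr2; lra.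
- by apply: is_cvg_geometric_series; rewrite ger0_norm// invf_lt1// ltr1n.
Qed.

(** Riesz-Fischer, with squared increments throughout so that no triangle inequality for the
    [L^2]-norm is required. Along a fast subsequence the weighted series [h] of squared increments
    has a finite integral, so it is finite almost everywhere and forces pointwise convergence;
    Fatou's lemma turns this into convergence of the whole sequence. *)
Theorem L2_complete (f : nat -> T -> R) :
  (forall n, measurable_fun D (f n)) ->
  (forall e, 0 < e -> exists M, forall n m, (M <= n)%N -> (M <= m)%N ->
     (sqdist (f n) (f m) <= e%:E)%E) ->
  exists2 g, measurable_fun D g &
    forall e, 0 < e -> exists M, forall n, (M <= n)%N -> (sqdist (f n) g <= e%:E)%E.
Proof.
move=> mf cf.
(* Chosen so that [4^k * e k = 2^-(k+1)]: the weights needed by [cvg_fast] keep the series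
   summable. *)
pose e k : R := (8 ^+ k * 2)^-1.
have e0 k : 0 < e k by rewrite invr_gt0 mulr_gt0 ?exprn_gt0.
have [s sP] : exists s : nat -> nat, forall k, [/\ (k <= s k)%N, (s k <= s k.+1)%N &
    forall m, (s k <= m)%N -> (sqdist (f m) (f (s k)) <= (e k)%:E)%E].
  apply: (@fast_subsequence (fun k n => forall m, (n <= m)%N ->
    (sqdist (f m) (f n) <= (e k)%:E)%E)).
  move=> k; have [M MP] := cf _ (e0 k).
  by exists M => n Mn m nm; apply: MP => //; exact: leq_trans nm.
pose u k x : R := 4 ^+ k * (f (s k.+1) x - f (s k) x) ^+ 2.
have mu_ k : measurable_fun D (EFin \o u k).
  apply/measurable_EFinP; apply: measurable_funM; first exact: measurable_cst.
  by apply/measurable_EFinP; exact: measurable_sqdist.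
have u0 k x : (0 <= (u k x)%:E)%E by rewrite lee_fin mulr_ge0 ?sqr_ge0 ?exprn_ge0.
pose h x := (\sum_(k <oo) (u k x)%:E)%E.
have mh : measurable_fun D h.
  by apply: ge0_emeasurable_sum => [k x _ _|k _]; [exact: u0|exact: mu_].
have ih : (\int[mu]_(x in D) h x < +oo)%E.
  rewrite integral_nneseries//.
  apply: (@le_lt_trans _ _ (\sum_(k <oo) (1 / (2 ^ k.+1)%:R)%:E)%E); last first.
    by apply: le_lt_trans (epsilon_trick0 xpredT _) _ => //; rewrite ltry.
  apply: lee_nneseries => [k _ _|k _]; first by apply: integral_ge0 => x _; exact: u0.
  under eq_integral do rewrite EFinM.
  rewrite ge0_integralZl_EFin//; last 2 first.
  - by move=> x _; rewrite lee_fin sqr_ge0.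
  - exact: measurable_sqdist.
  have [_ s1 /(_ _ s1) sk] := sP k.
  apply: (@le_trans _ _ ((4 ^+ k)%:E * (e k)%:E)%E).
    by rewrite lee_pmul2l// lte_fin exprn_gt0.
  rewrite -EFinM lee_fin /e natrX exprS (_ : 8 = 4 * 2 :> R); last by ring.
  rewrite exprMn le_eqVlt; apply/orP; left; apply/eqP.
  by field; rewrite !expf_neq0.
have [N [mN N0 subN]] : {ae mu, forall x, D x -> h x \is a fin_num}.
  apply: integrable_ae => //; apply/integrableP; split => //.
  by under eq_integral do rewrite gee0_abs ?nneseries_ge0//.
pose A := D `\` N.
have mA : measurable A by exact: measurableD.
have cA x : A x -> cvgn (fun k => f (s k) x).
  move=> [Dx Nx]; have hx : h x \is a fin_num.
    by apply: contrapT => hx; apply: Nx; apply: subN => /(_ Dx).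
  apply: (@cvg_fast _ (fine (h x))) => k; rewrite -lee_fin fineK//.
  apply: (@le_trans _ _ (\sum_(0 <= i < k.+1) (u i x)%:E)%E).
    by rewrite big_nat_recr//= leeDr// sume_ge0.
  exact: nneseries_lim_ge.
(* The indicator of [A] makes the sequence converge at every point, which is what measurability of
   the limit is deduced from. *)
pose G k x := f (s k) x * \1_A x.
have cG x : cvgn (G ^~ x).
  have [Ax|Ax] := pselect (A x).
    by apply: is_cvgM; [exact: cA|exact: is_cvg_cst].
  rewrite /G; under eq_fun do rewrite indicE memNset// mulr0.
  exact: is_cvg_cst.
pose g x := limn (G ^~ x).
have gE x : A x -> f (s k) x @[k --> \oo] --> g x.
  move=> Ax; have -> : g x = limn (fun k => f (s k) x); last exact: cA.
  by congr (limn _); apply/funext => k; rewrite /G indicE mem_set//= mulr1.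
have mg : measurable_fun D g.
  apply: (@measurable_fun_cvg _ _ _ D G) => [k|x _]; last exact: cG.
  apply: measurable_funM => //; exact: measurable_indic.
exists g => // r r0; have [M MP] := cf _ r0; exists M => n Mn.
rewrite /sqdist (ge0_negligible_integral mN)//; last 2 first.
- exact: measurable_sqdist.
- by move=> x _; rewrite lee_fin sqr_ge0.
(* The shift makes every index [s (k + M)] at least [M], so the Cauchy bound [r] holds for the
   integral of each [v k] and survives in Fatou's lemma. *)
pose v k x := ((f n x - f (s (k + M)%N) x) ^+ 2)%:E.
have mv k : measurable_fun A (v k).
  by apply: measurable_funS (@measurable_sqdist (f n) (f (s (k + M)%N)) _ _) => //; exact: subDsetl.
have -> : (\int[mu]_(x in D `\` N) ((f n x - g x) ^+ 2)%:E =
           \int[mu]_(x in A) limn_einf (v^~ x))%E.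
  apply: eq_integral => x /set_mem Ax.
  have vg : v k x @[k --> \oo] --> ((f n x - g x) ^+ 2)%:E.
    apply: cvg_EFin; first by near=> k.
    have vg : f n x - f (s (k + M)%N) x @[k --> \oo] --> f n x - g x.
      apply: cvgB; first exact: cvg_cst.
      by have := gE x Ax; rewrite -(cvg_shiftn M).
    by rewrite expr2; under eq_fun do rewrite /v /= expr2; exact: cvgM.
  by rewrite is_cvg_limn_einfE ?(cvg_lim _ vg)//; apply/cvg_ex; eexists; exact: vg.
apply: le_trans (fatou mu mA mv _) _; first by move=> k x _; rewrite lee_fin sqr_ge0.
rewrite limn_einf_lim; apply: lime_le; first exact: is_cvg_einfs.
near=> k; apply: (@le_trans _ _ (\int[mu]_(x in A) v k x)%E).
  by apply: ereal_inf_lbound; exists k => /=.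
apply: (@le_trans _ _ (sqdist (f n) (f (s (k + M)%N)))).
  apply: ge0_subset_integral => //; [exact: measurable_sqdist| |exact: subDsetl].
  by move=> x _; rewrite lee_fin sqr_ge0.
apply: MP => //; have [ksk _ _] := sP (k + M)%N.
by rewrite (leq_trans _ ksk)// leq_addl.
Unshelve. all: by end_near. Qed.

End L2_complete.

Section measurable_matrix_functions.
Context d (T : measurableType d) (R : realType) (m n : nat).
Variable D : set T.
Implicit Types F G : T -> 'M[R]_(m, n).

Lemma measurable_mxP F :
  measurable_fun D F <-> forall i j, measurable_fun D (fun x => F x i j).
Proof.
split=> [mF i j|mF].
  exact: (measurableT_comp (measurable_mx_coord i j) mF).
move=> mD; suff : measurable_fun D F by apply.
apply: (@measurability _ _ _ _ _ F (@mx_cylinder R m n)) => //.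
move=> _ [_ [i [j [B [mB ->]]]] <-].
exact: (mF i j mD B mB).
Qed.

Lemma measurable_mxD F G : measurable_fun D F -> measurable_fun D G ->
  measurable_fun D (fun x => F x + G x).
Proof.
move=> /measurable_mxP mF /measurable_mxP mG; apply/measurable_mxP => i j.
by under eq_fun do rewrite mxE; exact: measurable_funD.
Qed.

Lemma measurable_mxZ (c : T -> R) F : measurable_fun D c -> measurable_fun D F ->
  measurable_fun D (fun x => c x *: F x).
Proof.
move=> mc /measurable_mxP mF; apply/measurable_mxP => i j.
by under eq_fun do rewrite mxE; exact: measurable_funM.
Qed.

Lemma measurable_frob F G : measurable_fun D F -> measurable_fun D G ->
  measurable_fun D (fun x => frob (F x) (G x)).
Proof.
move=> /measurable_mxP mF /measurable_mxP mG.
by apply: measurable_sum => i; apply: measurable_sum => j; exact: measurable_funM.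
Qed.

End measurable_matrix_functions.

(** * The inner product of square-integrable fields and its completeness *)

Section square_integrable.
Variables (R : realType) (N : nat) (Omega : set 'rV[R]_N).
Hypothesis mO : measurable Omega.
Variables (m n : nat).
Implicit Types F G H : 'rV[R]_N -> 'M[R]_(m, n).

(** Extended-real valued, hence meaningful before integrability is known; [energyE] identifies it
    with [inner F F] afterwards. *)
Definition energy F : \bar R := (\int[volume]_(x in Omega) (frob (F x) (F x))%:E)%E.

Definition inner F G : R := \int[volume]_(x in Omega) frob (F x) (G x).

Lemma sqint_measurable F : square_integrable Omega F -> measurable_fun Omega F.
Proof. by case. Qed.

Lemma eq_energy F G : (forall x, Omega x -> F x = G x) -> energy F = energy G.
Proof. by move=> FG; apply: eq_integral => x /set_mem Ox; rewrite FG. Qed.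

Lemma le_energy F G : measurable_fun Omega F -> measurable_fun Omega G ->
  (forall x, Omega x -> frob (F x) (F x) <= frob (G x) (G x)) ->
  (energy F <= energy G)%E.
Proof.
move=> mF mG FG; apply: ge0_le_integral => //.
- by move=> x _; rewrite lee_fin frob_ge0.
- by apply/measurable_EFinP; exact: measurable_frob.
- by apply/measurable_EFinP; exact: measurable_frob.
Qed.

Lemma energyZ a F : measurable_fun Omega F ->
  energy (fun x => a *: F x) = ((a ^+ 2)%:E * energy F)%E.
Proof.
move=> mF; rewrite -ge0_integralZl_EFin ?sqr_ge0//.
- by apply: eq_integral => x _; rewrite frobZl frobZr mulrA -EFinM.
- by move=> x _; rewrite lee_fin frob_ge0.
- by apply/measurable_EFinP; exact: measurable_frob.
Qed.

Lemma energyD_le F G : measurable_fun Omega F -> measurable_fun Omega G ->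
  (energy (fun x => F x + G x)%R <= 2%:E * energy F + 2%:E * energy G)%E.
Proof.
move=> mF mG; have mFF := measurable_frob mF mF; have mGG := measurable_frob mG mG.
rewrite -!ge0_integralZl_EFin ?ler0n//.
1: rewrite -ge0_integralD//.
1: apply: ge0_le_integral => //.
all: try by move=> x _; rewrite ?lee_fin ?frob_ge0// ?adde_ge0// ?lee_fin ?mulr_ge0 ?frob_ge0.
all: try (by apply/measurable_EFinP).
all: try (by apply: emeasurable_funD; apply/measurable_EFinP; apply: measurable_funM).
all: try (by apply/measurable_EFinP; apply: measurable_funM).
  by apply/measurable_EFinP; apply: measurable_frob; exact: measurable_mxD.
by move=> x _; rewrite -!EFinM -EFinD lee_fin frobD_le.
Qed.

Lemma sqintD F G : square_integrable Omega F -> square_integrable Omega G ->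
  square_integrable Omega (fun x => F x + G x).
Proof.
move=> [mF iF] [mG iG]; split; first exact: measurable_mxD.
apply: le_lt_trans (energyD_le mF mG) _.
by rewrite lte_add_pinfty// lte_mul_pinfty.
Qed.

Lemma sqintZ a F : square_integrable Omega F ->
  square_integrable Omega (fun x => a *: F x).
Proof.
move=> [mF iF]; split; first by apply: measurable_mxZ.
by rewrite -/(energy _) energyZ// lte_mul_pinfty// lee_fin sqr_ge0.
Qed.

Lemma sqintB F G : square_integrable Omega F -> square_integrable Omega G ->
  square_integrable Omega (fun x => F x - G x).
Proof.
move=> qF qG; under eq_fun do rewrite -scaleN1r.
by apply: sqintD => //; exact: sqintZ.
Qed.

Lemma sqint_le F G : measurable_fun Omega F -> square_integrable Omega G ->
  (forall x, Omega x -> frob (F x) (F x) <= frob (G x) (G x)) ->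
  square_integrable Omega F.
Proof.
by move=> mF [mG iG] FG; split => //; apply: le_lt_trans iG; exact: le_energy.
Qed.

Lemma integrable_frob F G : square_integrable Omega F -> square_integrable Omega G ->
  volume.-integrable Omega (EFin \o (fun x => frob (F x) (G x))).
Proof.
have self H : square_integrable Omega H ->
    volume.-integrable Omega (EFin \o (fun x => frob (H x) (H x))).
  move=> [mH iH]; apply/integrableP; split.
    by apply/measurable_EFinP; exact: measurable_frob.
  by under eq_integral do rewrite /= ger0_norm ?frob_ge0//.
move=> qF qG; apply: le_integrable (integrableD mO (self _ qF) (self _ qG)) => //.
  by apply/measurable_EFinP; apply: measurable_frob; apply: sqint_measurable.
move=> x _ /=; rewrite lee_fin [leRHS]ger0_norm ?addr_ge0 ?frob_ge0//.
exact: frob_young.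
Qed.

Lemma energyE F : square_integrable Omega F -> energy F = (inner F F)%:E.
Proof.
move=> qF; rewrite /inner /Rintegral fineK//.
by have := integrable_fin_num mO (integrable_frob qF qF).
Qed.

Lemma innerC F G : inner F G = inner G F.
Proof. by rewrite /inner; under eq_Rintegral do rewrite frobC. Qed.

Lemma innerDl F G H : square_integrable Omega F -> square_integrable Omega G ->
  square_integrable Omega H -> inner (fun x => F x + G x) H = inner F H + inner G H.
Proof.
move=> qF qG qH; rewrite /inner; under eq_Rintegral do rewrite frobDl.
by rewrite RintegralD//; exact: integrable_frob.
Qed.

Lemma innerZl a F G : square_integrable Omega F -> square_integrable Omega G ->
  inner (fun x => a *: F x) G = a * inner F G.
Proof.
move=> qF qG; rewrite /inner; under eq_Rintegral do rewrite frobZl.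
by rewrite RintegralZl//; exact: integrable_frob.
Qed.

Lemma innerBl F G H : square_integrable Omega F -> square_integrable Omega G ->
  square_integrable Omega H -> inner (fun x => F x - G x) H = inner F H - inner G H.
Proof.
move=> qF qG qH; rewrite /inner; under eq_Rintegral do rewrite frobDl frobNl.
by rewrite RintegralB//; exact: integrable_frob.
Qed.

Lemma innerDr F G H : square_integrable Omega F -> square_integrable Omega G ->
  square_integrable Omega H -> inner H (fun x => F x + G x) = inner H F + inner H G.
Proof. by move=> ? ? ?; rewrite innerC innerDl// !(innerC H). Qed.

Lemma innerZr a F G : square_integrable Omega F -> square_integrable Omega G ->
  inner G (fun x => a *: F x) = a * inner G F.
Proof. by move=> ? ?; rewrite innerC innerZl// (innerC G). Qed.

Lemma innerBr F G H : square_integrable Omega F -> square_integrable Omega G ->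
  square_integrable Omega H -> inner H (fun x => F x - G x) = inner H F - inner H G.
Proof. by move=> ? ? ?; rewrite innerC innerBl// !(innerC H). Qed.

Lemma inner_sqrDZ t F G : square_integrable Omega F -> square_integrable Omega G ->
  inner (fun x => F x + t *: G x) (fun x => F x + t *: G x) =
  inner F F + 2 * t * inner F G + t ^+ 2 * inner G G.
Proof.
move=> qF qG; have qt := sqintZ t qG.
rewrite innerDl//; last exact: sqintD.
by rewrite !innerDr// !innerZl// !innerZr// (innerC G F); ring.
Qed.

Lemma eq_inner F F' G G' : (forall x, Omega x -> F x = F' x) ->
  (forall x, Omega x -> G x = G' x) -> inner F G = inner F' G'.
Proof.
by move=> FF GG; apply: eq_Rintegral => x /set_mem Ox; rewrite FF// GG.
Qed.

Lemma inner_ge0 F : 0 <= inner F F.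
Proof. by apply: Rintegral_ge0 => x _; exact: frob_ge0. Qed.

Lemma inner_monotone F G : (forall x, Omega x -> 0 <= frob (F x) (G x)) -> 0 <= inner F G.
Proof. by move=> FG; apply: Rintegral_ge0. Qed.

Lemma inner_CS F G : square_integrable Omega F -> square_integrable Omega G ->
  inner F G ^+ 2 <= inner F F * inner G G.
Proof.
move=> qF qG; have pos t : 0 <= inner F F + 2 * t * inner F G + t ^+ 2 * inner G G.
  by rewrite -inner_sqrDZ// inner_ge0.
have [GG|GG] := eqVneq (inner G G) 0.
  rewrite GG mulr0; have [->|FG] := eqVneq (inner F G) 0; first by rewrite expr0n.
  (* When [inner G G = 0] the polynomial is affine in [t], and at this [t] it would equal [-1]. *)
  have := pos (- (inner F F + 1) / 2 / inner F G).
  by rewrite GG mulr0 addr0 -mulrA divfK//; have := inner_ge0 F; lra.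
have G0 : 0 < inner G G by rewrite lt_neqAle eq_sym GG inner_ge0.
have H := pos (- (inner F G / inner G G)).
rewrite -ler_pdivrMr// -subr_ge0; apply: le_trans H _.
by rewrite le_eqVlt; apply/orP; left; apply/eqP; field.
Qed.

Lemma inner_young F G : square_integrable Omega F -> square_integrable Omega G ->
  2 * inner F G <= inner F F + inner G G.
Proof.
move=> qF qG; have := inner_ge0 (fun x => F x + (-1) *: G x).
by rewrite inner_sqrDZ//; lra.
Qed.

Definition L2norm F : R := Num.sqrt (inner F F).

Lemma inner_le_L2norm F G : square_integrable Omega F -> square_integrable Omega G ->
  `|inner F G| <= L2norm F * L2norm G.
Proof.
move=> qF qG; rewrite -sqrtr_sqr /L2norm -sqrtrM ?inner_ge0//.
by rewrite ler_wsqrtr// inner_CS.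
Qed.

Definition L2cvg (F_ : nat -> 'rV[R]_N -> 'M[R]_(m, n)) F : Prop :=
  inner (fun x => F_ k x - F x) (fun x => F_ k x - F x) @[k --> \oo] --> 0.

Lemma cvg_inner (F_ : nat -> 'rV[R]_N -> 'M[R]_(m, n)) F G :
  (forall k, square_integrable Omega (F_ k)) -> square_integrable Omega F ->
  square_integrable Omega G -> L2cvg F_ F -> inner (F_ k) G @[k --> \oo] --> inner F G.
Proof.
move=> qF_ qF qG FF.
have c0 : L2norm (fun x => F_ k x - F x) * L2norm G @[k --> \oo] --> 0.
  rewrite -[X in _ --> X](mul0r (L2norm G)); apply: cvgM; last exact: cvg_cst.
  rewrite -(sqrtr0 R); apply: continuous_cvg => //; exact: sqrt_continuous.
apply/cvgrPdist_le => e e0; move/cvgr0Pnorm_le : c0 => /(_ e e0).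
apply: filterS => k; rewrite ger0_norm; last by rewrite mulr_ge0 ?sqrtr_ge0.
apply: le_trans; rewrite distrC -innerBl//.
by apply: inner_le_L2norm => //; exact: sqintB.
Qed.

Lemma L2cvg_complete (F_ : nat -> 'rV[R]_N -> 'M[R]_(m, n)) :
  (forall k, square_integrable Omega (F_ k)) ->
  (forall e, 0 < e -> exists M, forall k l, (M <= k)%N -> (M <= l)%N ->
     inner (fun x => F_ k x - F_ l x) (fun x => F_ k x - F_ l x) <= e) ->
  exists2 F, square_integrable Omega F & L2cvg F_ F.
Proof.
move=> qF cF.
have mF k i j : measurable_fun Omega (fun x => F_ k x i j).
  by have [/measurable_mxP + _] := qF k; exact.
have /choice[f fP] (ij : 'I_m * 'I_n) : exists f : 'rV[R]_N -> R, measurable_fun Omega f /\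
    forall e, 0 < e -> exists M, forall k, (M <= k)%N ->
      (\int[volume]_(x in Omega) ((F_ k x ij.1 ij.2 - f x) ^+ 2)%:E <= e%:E)%E.
  have [//|e e0|g mg gP] := @L2_complete _ _ _ (@volume R N) _ mO (fun k x => F_ k x ij.1 ij.2).
    have [M MP] := cF _ e0; exists M => k l Mk Ml.
    apply: (@le_trans _ _ (energy (fun x => F_ k x - F_ l x))); last first.
      by rewrite energyE ?lee_fin ?MP//; exact: sqintB.
    apply: ge0_le_integral => //.
    - by move=> x _; rewrite lee_fin sqr_ge0.
    - by apply/measurable_EFinP; apply: measurable_funX; exact: measurable_funB.
    - apply/measurable_EFinP; apply: measurable_frob; apply: sqint_measurable; exact: sqintB.
    - move=> x _; rewrite lee_fin; apply: le_trans (frob_coord_le _ ij.1 ij.2).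
      by rewrite !mxE.
  by exists g.
pose F x : 'M[R]_(m, n) := \matrix_(i, j) f (i, j) x.
have mf ij : measurable_fun Omega (f ij) by have [] := fP ij.
have mFF : measurable_fun Omega F.
  apply/measurable_mxP => i j; rewrite /F; under eq_fun do rewrite mxE.
  exact: mf.
have cE e : 0 < e -> \forall k \near \oo, (energy (fun x => (F_ k x - F x)%R) <= e%:E)%E.
  (* There are [m * n] entries to sum; the successor also covers empty matrices. *)
  move=> e0; pose e' := e / (m * n).+1%:R.
  have e'0 : 0 < e' by rewrite divr_gt0.
  have : \forall k \near \oo, forall ij : 'I_m * 'I_n,
      (\int[volume]_(x in Omega) ((F_ k x ij.1 ij.2 - f ij x) ^+ 2)%:E <= e'%:E)%E.
    apply: filter_forall => ij; have [_ /(_ _ e'0)[M MP]] := fP ij.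
    by exists M => // k; exact: MP.
  apply: filterS => k kP; rewrite /energy.
  under eq_integral do rewrite /frob pair_bigA -sumEFin.
  rewrite ge0_integral_sum//=; last 2 first.
  - move=> ij; apply/measurable_EFinP; under eq_fun do rewrite !mxE.
    by apply: measurable_funM; apply: measurable_funB.
  - by move=> ij x _; rewrite lee_fin -expr2 sqr_ge0.
  apply: (@le_trans _ _ (\sum_(ij : 'I_m * 'I_n) e'%:E)%E).
    apply: lee_sum => -[i j] _; apply: le_trans (kP (i, j)).
    by under eq_integral do rewrite !mxE -expr2.
  rewrite sumEFin lee_fin sumr_const card_prod !card_ord /e' -[leLHS]mulr_natr mulrAC.
  by rewrite ler_pdivrMr// ler_pM2l// ler_nat.
have qFF : square_integrable Omega F.
  have [k _ /(_ k (leqnn k)) kP] := cE 1 ltr01.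
  (* [F] is written as [F_ k - (F_ k - F)], whose second term has energy at most [1] by the choice
     of [k]. *)
  split => //; apply: (@le_lt_trans _ _
    (energy (fun x => F_ k x + (-1) *: (F_ k x + (-1) *: F x))%R)).
    rewrite (@eq_energy _ F)// => x _.
    by rewrite !scaleN1r opprB addrC subrK.
  have [mk ik] := qF k.
  have mB : measurable_fun Omega (fun x => F_ k x + -1 *: F x).
    by apply: measurable_mxD => //; exact: measurable_mxZ.
  apply: le_lt_trans (energyD_le mk (measurable_mxZ _ mB)) _ => //.
  rewrite lte_add_pinfty ?lte_mul_pinfty// energyZ//.
  rewrite sqrrN expr1n mul1e; under eq_energy do rewrite scaleN1r.
  by apply: le_lt_trans kP _; rewrite ltry.
exists F => //; apply/cvgr0Pnorm_le => e e0; have := cE e e0.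
apply: filterS => k; rewrite energyE ?lee_fin; last exact: sqintB.
by rewrite ger0_norm// inner_ge0.
Qed.

Lemma energy0_ae F : square_integrable Omega F -> inner F F = 0 ->
  {ae volume, forall x, Omega x -> F x = 0}.
Proof.
move=> qF F0; have iF := integrable_frob qF qF.
have : (\int[volume]_(x in Omega) `|(frob (F x) (F x))%:E| = 0)%E.
  under eq_integral do rewrite gee0_abs ?lee_fin ?frob_ge0//.
  by rewrite -[LHS]/(energy F) energyE// F0.
move/ae_eq_integral_abs => /(_ mO (measurable_int _ iF)).
apply: filterS => x FF Ox; apply/eqP; rewrite -frob_eq0.
by have [->] := FF Ox.
Qed.

End square_integrable.

(** * Smooth functions and Borel sets *)

Section second_derivative.
Variables (R : realType) (V : normedModType R).
Implicit Types (f : V -> R) (x a b p : V).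

Lemma is_derive_line f p a (s : R) : derivable f (p + s *: a) a ->
  is_derive s 1 (fun s : R => f (p + s *: a)) ('D_a f (p + s *: a)).
Proof.
move=> df.
have E : (fun h : R => h^-1 *:
      (((fun s : R => f (p + s *: a)) \o shift s) (h *: 1) - f (p + s *: a))) =
         (fun h : R => h^-1 *: ((f \o shift (p + s *: a)) (h *: a) - f (p + s *: a))).
  apply/funext => h /=; congr (_ *: (f _ - _)).
  by rewrite scaler1 scalerDl addrCA.
by apply: DeriveDef; rewrite /derivable /derive ?E.
Qed.

Lemma diff_expansion f x : differentiable f x ->
  forall e, 0 < e -> \forall h \near 0, `|f (x + h) - f x - 'd f x h| <= e * `|h|.
Proof.
move=> df e e0; have /diff_locally /eqaddoP /(_ e e0) := df.
by apply: filterS => h /=; rewrite !fctE /shift /= opprD addrA [h + x]addrC.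
Qed.

Let Delta f x a b (t : R) : R :=
  f (x + t *: a + t *: b) - f (x + t *: a) - f (x + t *: b) + f x.

Let DeltaC f x a b t : Delta f x a b t = Delta f x b a t.
Proof. by rewrite /Delta (addrAC x); ring. Qed.

(** The mean value theorem along [a] turns the second difference into [t] times an increment of
    [F = 'D_a f], which is then expanded at [x]. Differentiability of [F] at the single point [x]
    suffices. *)
Let cvg_Delta f x a b : (forall y, differentiable f y) ->
  differentiable ('D_a f) x ->
  (Delta f x a b t) / t ^+ 2 @[t --> 0^'+] --> 'D_b ('D_a f) x.
Proof.
move=> df dF; rewrite (deriveE _ dF); set F := 'D_a f.
(* The two displacements [c a] and [t b + c a] are bounded by [t |a|] and [t (|a| + |b|)]; these
   bounds add up to [t (C - 1)], and the extra [1] keeps [C] positive. *)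
pose C := 2 * `|a| + `|b| + 1.
have C0 : 0 < C by rewrite ltr_wpDl// addr_ge0// mulr_ge0.
apply/cvgrPdist_le => e e0; have eC0 : 0 < e / C by rewrite divr_gt0.
have /nbhs_ballP[d /= d0 dP] := diff_expansion dF eC0.
near=> t.
have t0 : 0 < t by near: t; exact: nbhs_right_gt.
have td : t * C < d.
  rewrite -ltr_pdivlMr//; near: t; apply: nbhs_right_lt; exact: divr_gt0.
have close h : `|h| <= t * (C - 1) -> `|F (x + h) - F x - 'd F x h| <= e / C * `|h|.
  move=> ht; apply: dP; rewrite -ball_normE /ball_/= sub0r normrN.
  apply: le_lt_trans ht (le_lt_trans _ td).
  by rewrite ler_pM2l// gerBl.
pose g (s : R) := f (x + t *: b + s *: a) - f (x + s *: a).
pose g' (s : R) := F (x + t *: b + s *: a) - F (x + s *: a).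
have dg (s : R) : is_derive s 1 g (g' s).
  by apply: is_deriveB; apply: is_derive_line; exact: diff_derivable.
have [c /itvP ct] : exists2 c, c \in `]0, t[%R & g t - g 0 = g' c * (t - 0).
  apply: MVT => // s; apply: continuous_subspaceT => s'.
  by apply: differentiable_continuous; apply/derivable1_diffP; have [] := dg s'.
have -> : g t - g 0 = Delta f x a b t.
  by rewrite /g /Delta scale0r !addr0 [x + t *: b + _]addrAC; ring.
rewrite subr0 => ->; rewrite expr2 invfM mulrA mulfK ?lt0r_neq0//.

have ca : `|c *: a| <= t * `|a|.
  by rewrite normrZ ler_wpM2r// ger0_norm ?ct// ltW ?ct.
have cb : `|t *: b + c *: a| <= t * (`|a| + `|b|).
  rewrite (le_trans (ler_normD _ _))// mulrDr addrC lerD// normrZ.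
  by rewrite (ger0_norm (ltW t0)).
have := close (t *: b + c *: a); have := close (c *: a).
have -> : 'd F x (t *: b + c *: a) = t * 'd F x b + 'd F x (c *: a) by rewrite linearD linearZ.
rewrite /g' [x + (t *: b + _)]addrA.
set X := F (x + c *: a); set X' := F (x + t *: b + _); set Z := 'd F x (c *: a).
move=> H1 H2.
have {H1} H1 : `|X - F x - Z| <= e / C * (t * `|a|).
  apply: le_trans (H1 _) _; last by rewrite ler_pM2l.
  apply: le_trans ca _; rewrite ler_pM2l// /C.
  by have := normr_ge0 a; have := normr_ge0 b; lra.
have {H2} H2 : `|X' - F x - (t * 'd F x b + Z)| <= e / C * (t * (`|a| + `|b|)).
  apply: le_trans (H2 _) _; last by rewrite ler_pM2l.
  apply: le_trans cb _; rewrite ler_pM2l// /C.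
  by have := normr_ge0 a; have := normr_ge0 b; lra.
rewrite -(ler_pM2r t0) -[X in _ * X <= _](ger0_norm (ltW t0)) -normrM mulrBl divfK ?lt0r_neq0//.
have -> : 'd F x b * t - (X' - X) = (X - F x - Z) - (X' - F x - (t * 'd F x b + Z)) by ring.
apply: le_trans (ler_normB _ _) _; apply: le_trans (lerD H1 H2) _.
have -> : e / C * (t * `|a|) + e / C * (t * (`|a| + `|b|)) = e * t * ((C - 1) / C).
  by rewrite /C; field; rewrite lt0r_neq0.
rewrite ler_piMr ?mulr_ge0 ?ltW// ltr_pdivrMr// mul1r.
by rewrite ltrBlDl ltrDr.
Unshelve. all: by end_near. Qed.

(** Both iterated derivatives are limits of the same second difference, which is symmetric in [a]
    and [b]. *)
Lemma deriveC f x a b : (forall y, differentiable f y) ->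
  differentiable ('D_a f) x -> differentiable ('D_b f) x ->
  'D_b ('D_a f) x = 'D_a ('D_b f) x.
Proof.
move=> df da db; have := cvg_Delta (b := b) df da.
have := cvg_Delta (b := a) df db.
under eq_fun do rewrite DeltaC.
by move=> /(cvg_lim (@Rhausdorff R)) <- /(cvg_lim (@Rhausdorff R)) <-.
Qed.

End second_derivative.

(** * Measurability of open sets and finite volume of bounded sets *)

Section borel.
Variables (R : realType) (n : nat).

Lemma open_measurable_rV (U : set 'rV[R]_n) : open U -> measurable U.
Proof.
move=> oU.
(* Balls of the max-norm are cubes; those with rational centre and radius [1 / (k + 1)] form a
   countable family. *)
pose box (qk : 'rV[rat]_n * nat) : set 'rV[R]_n :=
  \bigcap_(i in [set: 'I_n]) [set x | `|x 0 i - ratr (qk.1 0 i)| < qk.2.+1%:R^-1].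
have -> : U = \bigcup_(qk in [set qk | box qk `<=` U]) box qk.
  apply/seteqP; split=> [x Ux|x [qk /= + xqk]]; last exact.
  have /nbhs_ballP[e /= e0 eU] : nbhs x U by exact: open_nbhs_nbhs.
  (* A cube of radius [1 / (k + 1)] that contains [x] lies in the ball of radius [2 / (k + 1)] about
     [x], hence the factor [2]. *)
  have [k _ /(_ k (leqnn k)) ke] : \forall k \near \oo, 2 / k.+1%:R < e.
    near=> k; rewrite ltr_pdivrMr// mulrC -ltr_pdivrMr//.
    by rewrite (lt_le_trans (y := k%:R))// ?ler_nat//; near: k; exact: nbhs_infty_gtr.
  have /choice[q qP] (i : 'I_n) : exists q : rat, `|x 0 i - ratr q| < k.+1%:R^-1.
    have [|q] := @rat_in_itvoo R (x 0 i - k.+1%:R^-1) (x 0 i + k.+1%:R^-1).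
      by rewrite ltrBlDr -addrA ltrDl addr_gt0.
    by rewrite in_itv /= => /andP[q1 q2]; exists q; rewrite ltr_distlC q1.
  exists (\row_i q i, k) => /=; last by move=> i _ /=; rewrite mxE.
  move=> y yq; apply: eU; split => // i j; rewrite (ord1 i).
  have /= := yq j I; rewrite mxE => yj; rewrite /ball /=.
  apply: le_lt_trans ke; rewrite mulrDl mul1r.
  apply: le_trans (ler_distD (ratr (q j)) _ _) _; rewrite lerD//; first exact/ltW/qP.
  by rewrite distrC ltW.
(* The union is reindexed by natural numbers through the countable encoding of the index type; codes
   of unsuitable cubes contribute the empty set. *)
have -> : \bigcup_(qk in [set qk | box qk `<=` U]) box qk =
    \bigcup_k (if unpickle k is Some qk then
                 if `[< box qk `<=` U >] then box qk else set0 else set0).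
  apply/seteqP; split => [x [qk bU bx]|x [k _]].
    by exists (pickle qk) => //; rewrite pickleK asboolT.
  by case: unpickle => // qk; case: asboolP => // bU bx; exists qk.
apply: bigcupT_measurable => k; case: unpickle => // qk; case: ifP => // _.
apply: fin_bigcap_measurable => // i _.
have mi : measurable_fun setT (fun x : 'rV[R]_n => `|x 0 i - ratr (qk.1 0 i)|).
  apply: measurableT_comp => //; apply: measurable_funB => //; exact: measurable_mx_coord.
have := mi measurableT _ (measurable_itv `]-oo, qk.2.+1%:R^-1[); rewrite setTI.
by congr measurable; apply/funext => x /=; rewrite in_itv.
Unshelve. all: by end_near. Qed.

Lemma continuous_measurable_rV (f : 'rV[R]_n -> R) : continuous f -> measurable_fun setT f.
Proof.
move=> cf; apply: (measurability _ (RGenOpens.measurableE R)).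
move=> _ [_ [a [b ->] <-]]; rewrite setTI; apply: open_measurable_rV.
by apply: open_comp => //; exact: interval_open.
Qed.

End borel.

(** By induction on the dimension: the slice of a cube at [x] is the cube of one dimension less if
    [|x| <= M], and empty otherwise. *)
Lemma volume_box_finite (R : realType) n (M : R) :
  (volume [set v : 'rV[R]_n | forall i, (`|v 0 i| <= M)%R] < +oo)%E.
Proof.
elim: n => [|n IH] /=.
  by rewrite diracE ltry.
set B := [set v : 'rV[R]_n | forall i, `|v 0 i| <= M] in IH *.
apply: (@le_lt_trans _ _
  (\int[lebesgue_measure]_x ((fine (volume B))%:E * (\1_(`[- M, M]) x)%:E))%E).
  have E (x : R) : volume [set v : 'rV[R]_n |
      [set v : 'rV[R]_n.+1 | forall i, (`|v 0 i| <= M)%R] (row_cons x v)] =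
     (if (`|x| <= M)%R then volume B else 0)%E.
    case: ifPn => xM.
      congr (volume _); apply/seteqP; split => v /= H i.
        by have := H (lift ord0 i); rewrite /row_cons mxE liftK.
      by rewrite /row_cons mxE; case: unlift.
    rewrite (_ : [set v | _] = set0) ?measure0//.
    apply/seteqP; split => // v /= /(_ ord0); rewrite /row_cons mxE unlift_none.
    by rewrite (negbTE xM).
  under eq_integral do rewrite E.
  rewrite le_eqVlt; apply/orP; left; apply/eqP; apply: eq_integral => x _.
  rewrite indicE mem_setE in_itv /= -ler_norml; case: ifP => _.
    by rewrite mule1 fineK// ge0_fin_numE.
  by rewrite mule0.
rewrite ge0_integralZl_EFin ?fine_ge0//; last first.
  by apply/measurable_EFinP; exact: measurable_indic.
rewrite integral_indic// setIT lte_mul_pinfty//.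
  by rewrite lee_fin fine_ge0.
rewrite [X in (X < _)%E](lebesgue_measure_itv `[- M, M]) /=.
by case: ifP => _; rewrite ltry.
Qed.

Lemma volume_bounded_finite (R : realType) n (A : set 'rV[R]_n) :
  measurable A -> bounded_set A -> (volume A < +oo)%E.
Proof.
move=> mA [M [Mr MA]].
(* [bounded_set] gives a bound only for radii strictly above [M], hence [M + 1]. Written as a finite
   intersection, the cube is visibly measurable. *)
pose B := \bigcap_(i in [set: 'I_n]) [set v : 'rV[R]_n | `|v 0 i| <= M + 1].
have AB : A `<=` B.
  move=> v Av i _ /=; have := MA (M + 1) _ v Av; rewrite ltrDl ltr01 => /(_ isT).
  apply: le_trans; rewrite -[leRHS]/(mx_norm v) mx_normrE.
  exact: (le_bigmax _ (fun ij : 'I_1 * 'I_n => `|v ij.1 ij.2|) (0, i)).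
have BE : B = [set v : 'rV[R]_n | forall i, `|v 0 i| <= M + 1].
  by apply/seteqP; split => v vB i => [|_]; exact: vB.
have mB : measurable B.
  apply: fin_bigcap_measurable => // i _; 
  have mi : measurable_fun setT (fun x : 'rV[R]_n => `|x 0 i|).
    by apply: measurableT_comp => //; exact: measurable_mx_coord.
  have := mi measurableT _ (measurable_itv `]-oo, (M + 1)]); rewrite setTI.
  by congr measurable; apply/funext => x /=; rewrite in_itv.
apply: (@le_lt_trans _ _ (volume B)); first by apply: le_measure => //; rewrite inE.
by rewrite BE; exact: volume_box_finite.
Qed.

(** * Calculus of smooth functions and test functions *)

Section smooth.
Variables (R : realType) (N : nat).
Implicit Types (phi psi : 'rV[R]_N -> R) (i j : 'I_N).

Lemma smooth_differentiable phi x : smooth phi -> differentiable phi x.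
Proof. by move=> /(_ [::]). Qed.

Lemma smooth_partial j phi : smooth phi -> smooth (partial j phi).
Proof. by move=> sphi s x; have := sphi (rcons s j) x; rewrite foldr_rcons. Qed.

Lemma partial_comb j a b phi psi x : differentiable phi x -> differentiable psi x ->
  partial j (fun x => a * phi x + b * psi x) x = a * partial j phi x + b * partial j psi x.
Proof.
move=> /diff_derivable-/(_ (delta_mx 0 j)) dphi.
move=> /diff_derivable-/(_ (delta_mx 0 j)) dpsi.
rewrite /partial -[X in 'D__ X _]/((a \*: phi) + (b \*: psi)).
have da : derivable (a \*: phi) x (delta_mx 0 j) by exact: derivableZ.
have db : derivable (b \*: psi) x (delta_mx 0 j) by exact: derivableZ.
by rewrite (deriveD da db) (deriveZ _ dphi) (deriveZ _ dpsi).
Qed.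

Lemma smooth_comb a b phi psi : smooth phi -> smooth psi ->
  smooth (fun x => a * phi x + b * psi x).
Proof.
move=> sphi spsi s; suff -> : foldr (@partial R N) (fun x => a * phi x + b * psi x) s =
    (fun x => a * foldr (@partial R N) phi s x + b * foldr (@partial R N) psi s x).
  by move=> x; apply: differentiableD; apply: differentiableM => //.
elim: s => //= j s ->; apply/funext => x; exact: partial_comb.
Qed.

Lemma partialC i j phi x : smooth phi ->
  partial i (partial j phi) x = partial j (partial i phi) x.
Proof.
move=> sphi; apply: deriveC => [y||]; first exact: smooth_differentiable.
- by apply: (@smooth_differentiable (partial j phi)); exact: smooth_partial.
- by apply: (@smooth_differentiable (partial i phi)); exact: smooth_partial.
Qed.

Let derive_coord j (v x : 'rV[R]_N) : 'D_v (fun x : 'rV[R]_N => x 0 j) x = v 0 j.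
Proof.
apply: cvg_lim => //; apply: cvg_near_cst; near=> h.
by rewrite /= !mxE addrK /GRing.scale /= mulKf//; near: h; exact: nbhs_dnbhs_neq.
Unshelve. all: by end_near. Qed.

Lemma partial_coordM i j phi x : differentiable phi x ->
  partial i (fun x => x 0 j * phi x) x = (j == i)%:R * phi x + x 0 j * partial i phi x.
Proof.
move=> /diff_derivable-/(_ (delta_mx 0 i)) dphi.
have /diff_derivable-/(_ (delta_mx 0 i)) dc :
  differentiable (fun x : 'rV[R]_N => x 0 j) x by exact: differentiable_coord.
rewrite /partial -[X in 'D__ X _]/((fun x : 'rV[R]_N => x 0 j) * phi).
rewrite (deriveM dc dphi).
rewrite addrC derive_coord mxE eqxx /=; congr (_ + _).
by rewrite /GRing.scale /= mulrC.
Qed.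

Lemma smooth_coordM j phi : smooth phi -> smooth (fun x => x 0 j * phi x).
Proof.
move=> sphi s.
(* The form [x_j p + q] is stable under partial derivatives, whereas [x_j phi] alone is not; this is
   the induction hypothesis that works. *)
have [p [q [sp sq ->]]] : exists p q, [/\ smooth p, smooth q &
    foldr (@partial R N) (fun x => x 0 j * phi x) s = fun x => x 0 j * p x + q x].
  elim: s => [|i s [p [q [sp sq /= ->]]]].
    exists phi, (fun=> 0); split => //; last by apply/funext => x; rewrite addr0.
    have -> : (fun=> 0) = (fun x => 0 * phi x + 0 * phi x).
      by apply/funext => x; rewrite !mul0r addr0.
    exact: smooth_comb.
  exists (partial i p), (fun x => (j == i)%:R * p x + 1 * partial i q x); split.
  - exact: smooth_partial.
  - by apply: smooth_comb => //; exact: smooth_partial.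
  - apply/funext => x; rewrite mul1r addrA [x 0 j * _ + _]addrC.
    have -> : (fun x : 'rV[R]_N => x 0 j * p x + q x) =
        (fun x => 1 * (x 0 j * p x) + 1 * q x).
      by apply/funext => y; rewrite !mul1r.
    rewrite partial_comb ?mul1r; last exact: smooth_differentiable.
      by rewrite partial_coordM//; exact: smooth_differentiable.
    by apply: differentiableM; [exact: differentiable_coord|exact: smooth_differentiable].
move=> x; apply: differentiableD; last exact: smooth_differentiable.
by apply: differentiableM; [exact: differentiable_coord|exact: smooth_differentiable].
Qed.

Variable Omega : set 'rV[R]_N.

Let support phi := closure [set x | phi x != 0].

Let test_functionS phi psi : test_function Omega phi -> smooth psi ->
  support psi `<=` support phi -> test_function Omega psi.
Proof.
move=> [_ cphi Ophi] spsi sub; split => //; last exact: subset_trans Ophi.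
by apply: subclosed_compact cphi sub; exact: closed_closure.
Qed.

(** Off its closed support [phi] vanishes on a whole ball, so its difference quotients vanish there:
    differentiation does not enlarge the support. *)
Lemma test_function_partial j phi :
  test_function Omega phi -> test_function Omega (partial j phi).
Proof.
move=> tphi; have [sphi _ _] := tphi; apply: test_functionS tphi (smooth_partial _ _) _ => //.
have cC : closed (support phi) by exact: closed_closure.
rewrite /support [X in _ `<=` X]((closure_id _).1 cC); apply: closure_subset => x /= px.
apply: contrapT => nx; move/eqP: px; apply.
have : nbhs x (~` support phi) by apply: open_nbhs_nbhs; split => //; exact: closed_openC.
move=> /nbhs_ballP[e /= e0 eP].
have phi0 y : ball x e y -> phi y = 0.
  by move=> /eP; apply: contra_notP => py; apply: subset_closure; exact/eqP.
have c : h *: (delta_mx 0 j : 'rV[R]_N) + x @[h --> (0 : R)] --> 0 *: (delta_mx 0 j : 'rV[R]_N) + x.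
  by apply: cvgD; [apply: cvgZ => //; exact: cvg_cst|exact: cvg_cst].
rewrite scale0r add0r in c.
apply: cvg_lim => //; apply: cvg_near_cst; near=> h => /=.
rewrite !phi0 ?subrr ?scaler0//; first exact: ballxx.
by near: h; apply: nbhs_dnbhs; exact: cvg_ball c _ e0.
Unshelve. all: by end_near. Qed.

Lemma test_function_coordM j phi :
  test_function Omega phi -> test_function Omega (fun x => x 0 j * phi x).
Proof.
move=> tphi; have [sphi _ _] := tphi; apply: test_functionS tphi (smooth_coordM _ _) _ => //.
by apply: closure_subset => x /=; rewrite mulf_eq0 negb_or => /andP[].
Qed.

Lemma test_function_comb a b phi psi : test_function Omega phi -> test_function Omega psi ->
  test_function Omega (fun x => a * phi x + b * psi x).
Proof.
move=> [sphi cphi Ophi] [spsi cpsi Opsi].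
have sub : closure [set x | a * phi x + b * psi x != 0] `<=` support phi `|` support psi.
  rewrite -closureU; apply: closure_subset => x /=.
  have [->|] := eqVneq (phi x) 0; last by left.
  have [->|] := eqVneq (psi x) 0; last by right.
  by rewrite !mulr0 addr0 eqxx.
split; first exact: smooth_comb.
  apply: subclosed_compact (compactU cphi cpsi) sub; exact: closed_closure.
by apply: subset_trans sub _; rewrite subUset.
Qed.

Lemma test_function_bounded phi : test_function Omega phi ->
  exists M, forall x, `|phi x| <= M.
Proof.
move=> [sphi cphi _].
have cont : continuous phi.
  by move=> x; apply: differentiable_continuous; exact: smooth_differentiable.
have := continuous_compact (continuous_subspaceT cont) cphi.
(* Compactness bounds [phi] on its support only; the maximum with [0] takes care of the points where
   [phi] vanishes. *)
move=> /compact_bounded[M [_ MP]]; exists (Num.max 0 (M + 1)) => x.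
have [->|p0] := eqVneq (phi x) 0; first by rewrite normr0 le_max lexx.
rewrite le_max; apply/orP; right; apply: (MP (M + 1)); first by rewrite ltrDl.
by exists x => //; apply: subset_closure.
Qed.

Lemma test_function_measurable phi : test_function Omega phi -> measurable_fun setT phi.
Proof.
move=> [sphi _ _]; apply: continuous_measurable_rV => x.
by apply: differentiable_continuous; exact: smooth_differentiable.
Qed.

End smooth.

Section square_integrable_combinations.
Variables (R : realType) (N : nat) (Omega : set 'rV[R]_N).
Hypothesis mO : measurable Omega.

Lemma sqint_comb m n a b (F G : 'rV[R]_N -> 'M[R]_(m, n)) :
  square_integrable Omega F -> square_integrable Omega G ->
  square_integrable Omega (fun x => a *: F x + b *: G x).
Proof. by move=> qF qG; apply: sqintD => //; exact: sqintZ. Qed.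

Lemma inner_combl m n a b (F G H : 'rV[R]_N -> 'M[R]_(m, n)) :
  square_integrable Omega F -> square_integrable Omega G -> square_integrable Omega H ->
  inner Omega (fun x => a *: F x + b *: G x) H = a * inner Omega F H + b * inner Omega G H.
Proof.
move=> qF qG qH; have qa := sqintZ mO a qF; have qb := sqintZ mO b qG.
by rewrite innerDl// !innerZl.
Qed.

Lemma inner_comb_le m n a b (F G : 'rV[R]_N -> 'M[R]_(m, n)) :
  square_integrable Omega F -> square_integrable Omega G ->
  inner Omega (fun x => a *: F x + b *: G x) (fun x => a *: F x + b *: G x) <=
  2 * a ^+ 2 * inner Omega F F + 2 * b ^+ 2 * inner Omega G G.
Proof.
move=> qF qG; have qa := sqintZ mO a qF; have qb := sqintZ mO b qG.
have := inner_ge0 Omega (fun x => a *: F x + (-1) *: (b *: G x)).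
rewrite inner_sqrDZ// => H.
rewrite innerDl//; last exact: sqintD.
rewrite !innerDr// (innerC _ (fun x => b *: G x) (fun x => a *: F x)).
have e1 : inner Omega (fun x => a *: F x) (fun x => a *: F x) = a ^+ 2 * inner Omega F F.
  by rewrite innerZl// innerZr// mulrA.
have e2 : inner Omega (fun x => b *: G x) (fun x => b *: G x) = b ^+ 2 * inner Omega G G.
  by rewrite innerZl// innerZr// mulrA.
by move: H; rewrite e1 e2; lra.
Qed.

Lemma sqint0 m n : square_integrable Omega (fun=> 0 : 'M[R]_(m, n)).
Proof.
split; first exact: measurable_cst.
by under eq_integral do rewrite frob0l; rewrite integral0 ltry.
Qed.

Lemma sqint_sum m n (I : Type) (r : seq I) (G : I -> 'rV[R]_N -> 'M[R]_(m, n)) :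
  (forall i, square_integrable Omega (G i)) ->
  square_integrable Omega (fun x => \sum_(i <- r) G i x).
Proof.
move=> qG; elim: r => [|i r IH].
  by under eq_fun do rewrite big_nil; exact: sqint0.
by under eq_fun do rewrite big_cons; exact: sqintD.
Qed.

Lemma inner_sumr m n (I : Type) (r : seq I) (F : 'rV[R]_N -> 'M[R]_(m, n)) G :
  square_integrable Omega F -> (forall i, square_integrable Omega (G i)) ->
  inner Omega F (fun x => \sum_(i <- r) G i x) = \sum_(i <- r) inner Omega F (G i).
Proof.
move=> qF qG; elim: r => [|i r IH].
  rewrite big_nil; under eq_fun do rewrite big_nil.
  by rewrite /inner; under eq_Rintegral do rewrite frobC frob0l; rewrite Rintegral_cst// mul0r.
rewrite big_cons; under eq_fun do rewrite big_cons.
by rewrite innerDr ?IH//; exact: sqint_sum.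
Qed.

Lemma sqint_bounded m n (F : 'rV[R]_N -> 'M[R]_(m, n)) C : (volume Omega < +oo)%E ->
  measurable_fun Omega F -> (forall x, Omega x -> frob (F x) (F x) <= C) ->
  square_integrable Omega F.
Proof.
move=> vO mF FC; split => //.
apply: (@le_lt_trans _ _ (\int[volume]_(x in Omega) (`|C|)%:E)%E).
  apply: ge0_le_integral => //.
  - by move=> x _; rewrite lee_fin frob_ge0.
  - by apply/measurable_EFinP; exact: measurable_frob.
  - by move=> x Ox; rewrite lee_fin (le_trans (FC x Ox))// ler_norm.
by rewrite integral_cst// lte_mul_pinfty.
Qed.

Lemma inner_ae0 m n (F G : 'rV[R]_N -> 'M[R]_(m, n)) :
  square_integrable Omega F -> square_integrable Omega G ->
  {ae volume, forall x, Omega x -> frob (F x) (G x) = 0} -> inner Omega F G = 0.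
Proof.
move=> qF qG FG; have -> : inner Omega F G = fine (\int[volume]_(x in Omega) (cst 0%E) x).
  congr fine; apply: ae_eq_integral => //.
    by have := integrable_frob mO qF qG; apply: measurable_int.
  by apply: filterS FG => x H Ox /=; rewrite H.
by rewrite integral0.
Qed.

Lemma L2cvg_comb m n a b (F_ G_ : nat -> 'rV[R]_N -> 'M[R]_(m, n)) F G :
  (forall k, square_integrable Omega (F_ k)) -> (forall k, square_integrable Omega (G_ k)) ->
  square_integrable Omega F -> square_integrable Omega G ->
  L2cvg Omega F_ F -> L2cvg Omega G_ G ->
  L2cvg Omega (fun k x => a *: F_ k x + b *: G_ k x) (fun x => a *: F x + b *: G x).
Proof.
move=> qF_ qG_ qF qG FF GG.
apply: (@squeeze_cvgr _ _ _ _ (fun=> 0) (fun k =>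
  2 * a ^+ 2 * inner Omega (fun x => F_ k x - F x) (fun x => F_ k x - F x) +
  2 * b ^+ 2 * inner Omega (fun x => G_ k x - G x) (fun x => G_ k x - G x))).
- near=> k; rewrite inner_ge0/=.
  rewrite [leLHS](@eq_inner _ _ _ _ _ _ (fun x => a *: (F_ k x - F x) + b *: (G_ k x - G x)) _
    (fun x => a *: (F_ k x - F x) + b *: (G_ k x - G x))).
  + by apply: inner_comb_le; exact: sqintB.
  + by move=> x _; rewrite !scalerBr opprD addrACA.
  + by move=> x _; rewrite !scalerBr opprD addrACA.
- exact: cvg_cst.
- rewrite -[X in _ --> X](addr0 0) -[X in _ --> X + _](mulr0 (2 * a ^+ 2)).
  rewrite -[X in _ --> _ + X](mulr0 (2 * b ^+ 2)).
  by apply: cvgD; apply: cvgM => //; exact: cvg_cst.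
Unshelve. all: by end_near. Qed.

End square_integrable_combinations.

(** * Weak gradients and zero boundary values *)

Section sobolev.
Variables (R : realType) (N : nat) (Omega : set 'rV[R]_N).
Hypothesis mO : measurable Omega.
Hypothesis vO : (volume Omega < +oo)%E.
Implicit Types phi : 'rV[R]_N -> R.
Notation sqint := (square_integrable Omega).
Notation ip := (inner Omega).

Definition test_field (f : 'rV[R]_N -> 'rV[R]_N) : Prop :=
  forall i, test_function Omega (fun x => f x 0 i).

Lemma frob_scale_delta m n (A : 'M[R]_(m, n)) c i j : frob A (c *: delta_mx i j) = c * A i j.
Proof.
rewrite frobZr; congr (_ * _); rewrite /frob (bigD1 i)//= (bigD1 j)//= mxE !eqxx mulr1.
rewrite !big1 ?addr0// => [k /negPf ki|k /negPf kj]; last by rewrite mxE kj andbF mulr0.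
by rewrite big1// => l _; rewrite mxE ki mulr0.
Qed.

Lemma sqint_test_scale m n phi (B : 'M[R]_(m, n)) :
  test_function Omega phi -> sqint (fun x => phi x *: B).
Proof.
move=> tphi; have [M MP] := test_function_bounded tphi.
apply: (@sqint_bounded _ _ _ mO _ _ _ (M ^+ 2 * frob B B)) => //.
  apply: measurable_mxZ => //.
  by apply: measurable_funS (test_function_measurable tphi).
move=> x _; rewrite frobZl frobZr mulrA -expr2 ler_wpM2r ?frob_ge0//.
rewrite -[leLHS]real_normK ?num_real// ler_sqr ?nnegrE//.
by rewrite (le_trans _ (MP x)).
Qed.

Lemma sqint_test_entries m n (F : 'rV[R]_N -> 'M[R]_(m, n)) :
  (forall i j, test_function Omega (fun x => F x i j)) -> sqint F.
Proof.
move=> tF.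
have -> : F = (fun x => \sum_(ij : 'I_m * 'I_n) F x ij.1 ij.2 *: delta_mx ij.1 ij.2).
  by apply/funext => x; rewrite [LHS]matrix_sum_delta pair_bigA.
by apply: sqint_sum => // ij; exact: sqint_test_scale.
Qed.

Lemma sqint_test_field f : test_field f -> sqint f.
Proof. by move=> tf; apply: sqint_test_entries => i j; rewrite (ord1 i). Qed.

Lemma sqint_jacobian f : test_field f -> sqint (jacobian_field f).
Proof.
move=> tf; apply: sqint_test_entries => i j.
have -> : (fun x => jacobian_field f x i j) = partial j (fun x => f x 0 i).
  by apply/funext => x; rewrite mxE.
exact: test_function_partial.
Qed.

Lemma test_field_comb a b f f' : test_field f -> test_field f' ->
  test_field (fun x => a *: f x + b *: f' x).
Proof.
by move=> tf tf' i; under eq_fun do rewrite !mxE; exact: test_function_comb.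
Qed.

Lemma jacobian_comb a b f f' x : test_field f -> test_field f' ->
  jacobian_field (fun x => a *: f x + b *: f' x) x =
  a *: jacobian_field f x + b *: jacobian_field f' x.
Proof.
move=> tf tf'; apply/matrixP => i j; rewrite !mxE.
under [X in partial _ X]eq_fun do rewrite !mxE.
by apply: partial_comb; apply: smooth_differentiable; [case: (tf i)|case: (tf' i)].
Qed.

(** Integration by parts phrased as an inner product with fields concentrated in one entry, so that
    linear combinations and [L^2]-limits follow from bilinearity and continuity of [ip]. *)
Definition weak_gradient (f : 'rV[R]_N -> 'rV[R]_N) (G : 'rV[R]_N -> 'M[R]_N) : Prop :=
  forall phi, test_function Omega phi -> forall i j,
    ip f (fun x => partial j phi x *: delta_mx 0 i) = - ip G (fun x => phi x *: delta_mx i j).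

Lemma weak_gradientP f G : weak_gradient f G <->
  (forall phi, test_function Omega phi -> forall i j : 'I_N,
        \int[volume]_(x in Omega) (f x 0 i * partial j phi x) =
        - \int[volume]_(x in Omega) (G x i j * phi x)).
Proof.
have E1 phi i j : ip f (fun x => partial j phi x *: delta_mx 0 i) =
    \int[volume]_(x in Omega) (f x 0 i * partial j phi x).
  by apply: eq_Rintegral => x _; rewrite frob_scale_delta mulrC.
have E2 phi i j : ip G (fun x => phi x *: delta_mx i j) =
    \int[volume]_(x in Omega) (G x i j * phi x).
  by apply: eq_Rintegral => x _; rewrite frob_scale_delta mulrC.
by split => H phi tphi i j; have := H phi tphi i j; rewrite E1 E2.
Qed.

Lemma weak_gradient_comb a b f f' G G' : sqint f -> sqint f' -> sqint G -> sqint G' ->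
  weak_gradient f G -> weak_gradient f' G' ->
  weak_gradient (fun x => a *: f x + b *: f' x) (fun x => a *: G x + b *: G' x).
Proof.
move=> qf qf' qG qG' wf wf' phi tphi i j.
have tp := test_function_partial j tphi.
rewrite !inner_combl//; try exact: sqint_test_scale.
by rewrite wf// wf'//; ring.
Qed.

Lemma weak_gradient_lim f_ f G_ G :
  (forall k, sqint (f_ k)) -> (forall k, sqint (G_ k)) -> sqint f -> sqint G ->
  L2cvg Omega f_ f -> L2cvg Omega G_ G -> (forall k, weak_gradient (f_ k) (G_ k)) ->
  weak_gradient f G.
Proof.
move=> qf_ qG_ qf qG cf cG w phi tphi i j.
have tp := test_function_partial j tphi.
have c1 := cvg_inner mO qf_ qf (sqint_test_scale (delta_mx 0 i) tp) cf.
have c2 : - ip (G_ k) (fun x => phi x *: delta_mx i j) @[k --> \oo] -->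
    - ip G (fun x => phi x *: delta_mx i j).
  by apply: cvgN; apply: cvg_inner => //; exact: sqint_test_scale.
have e : (fun k => ip (f_ k) (fun x => partial j phi x *: delta_mx 0 i)) =
    (fun k => - ip (G_ k) (fun x => phi x *: delta_mx i j)).
  by apply/funext => k; rewrite w.
rewrite e in c1; by rewrite -(cvg_lim _ c1)// -(cvg_lim _ c2).
Qed.

(** Zero boundary values for a pair of fields not yet bundled into an element of [H1 Omega]: limits
    are formed first and packaged by [Y_of] afterwards. *)
Definition smooth_approx (f : 'rV[R]_N -> 'rV[R]_N) (G : 'rV[R]_N -> 'M[R]_N) : Prop :=
  exists f_ : nat -> 'rV[R]_N -> 'rV[R]_N, [/\ forall k, test_field (f_ k),
    L2cvg Omega f_ f & L2cvg Omega (fun k => jacobian_field (f_ k)) G].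

Lemma H1_normE f G : sqint f -> sqint G ->
  H1_norm Omega f G = (Num.sqrt (ip f f + ip G G))%:E.
Proof.
move=> qf qG; rewrite /H1_norm -[RHS]/(sqrte (ip f f + ip G G)%:E); congr sqrte.
rewrite EFinD -!energyE// -ge0_integralD//.
- by move=> x _; rewrite lee_fin frob_ge0.
- by apply/measurable_EFinP; apply: measurable_frob; exact: sqint_measurable.
- by move=> x _; rewrite lee_fin frob_ge0.
- by apply/measurable_EFinP; apply: measurable_frob; exact: sqint_measurable.
Qed.

(** The arbitrary filter covers both the sequences behind zero boundary values and the one-sided
    limit [t -> 0] of the directional derivative. *)
Lemma cvg_H1_norm (T : Type) (F : set_system T) {FF : Filter F}
    (f_ : T -> 'rV[R]_N -> 'rV[R]_N) (G_ : T -> 'rV[R]_N -> 'M[R]_N) :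
  (forall t, sqint (f_ t)) -> (forall t, sqint (G_ t)) ->
  (H1_norm Omega (f_ t) (G_ t) @[t --> F] --> 0%E) <->
  (ip (f_ t) (f_ t) @[t --> F] --> 0) /\ (ip (G_ t) (G_ t) @[t --> F] --> 0).
Proof.
move=> qf qG; under eq_fun do rewrite H1_normE//.
split=> [/fine_cvg/= c|[c1 c2]].
  have c2 : ip (f_ t) (f_ t) + ip (G_ t) (G_ t) @[t --> F] --> 0.
    rewrite -[X in _ --> X](mul0r 0).
    apply: (@cvg_trans _ (Num.sqrt (ip (f_ t) (f_ t) + ip (G_ t) (G_ t)) *
      Num.sqrt (ip (f_ t) (f_ t) + ip (G_ t) (G_ t)) @[t --> F])).
      apply: near_eq_cvg; near=> t.
      by rewrite -expr2 sqr_sqrtr// addr_ge0// inner_ge0.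
    exact: cvgM.
  split; apply: (@squeeze_cvgr _ _ _ _ (fun=> 0) _ _ _ _ _ c2); try exact: cvg_cst.
    by near=> t; rewrite inner_ge0 lerDl inner_ge0.
  by near=> t; rewrite inner_ge0 lerDr inner_ge0.
apply: cvg_EFin; first by near=> t.
rewrite -(sqrtr0 R); apply: continuous_cvg; first exact: sqrt_continuous.
by rewrite -[X in _ --> X](addr0 0); exact: cvgD.
Unshelve. all: by end_near. Qed.

Lemma vanishes_on_boundaryP (y : H1 Omega) :
  vanishes_on_boundary y <-> smooth_approx y (grad y).
Proof.
have qy := fld_sqint y; have qG := grad_sqint y.
split=> [[f [tf]]|[f [tf c1 c2]]].
  by move/cvg_H1_norm => []; [move=> k; apply: sqintB => //; exact: sqint_test_field
    |move=> k; apply: sqintB => //; exact: sqint_jacobian|exists f].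
exists f; split => //; apply/cvg_H1_norm.
- by move=> k; apply: sqintB => //; exact: sqint_test_field.
- by move=> k; apply: sqintB => //; exact: sqint_jacobian.
- by split.
Qed.

Lemma smooth_approx_comb a b f f' G G' : sqint f -> sqint f' -> sqint G -> sqint G' ->
  smooth_approx f G -> smooth_approx f' G' ->
  smooth_approx (fun x => a *: f x + b *: f' x) (fun x => a *: G x + b *: G' x).
Proof.
move=> qf qf' qG qG' [f_ [tf c1 c2]] [f'_ [tf' c1' c2']].
exists (fun k x => a *: f_ k x + b *: f'_ k x); split.
- by move=> k; exact: test_field_comb.
- by apply: L2cvg_comb => // k; exact: sqint_test_field.
- have -> : (fun k => jacobian_field (fun x => a *: f_ k x + b *: f'_ k x)) =
    (fun k x => a *: jacobian_field (f_ k) x + b *: jacobian_field (f'_ k) x).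
    by apply/funext => k; apply/funext => x; exact: jacobian_comb.
  by apply: L2cvg_comb => // k; exact: sqint_jacobian.
Qed.

(** Diagonal argument: the [k]-th test field is within [1 / (k + 1)] of the pair [f_ k], [G_ k] in
    squared distance. *)
Lemma smooth_approx_lim f_ f G_ G :
  (forall k, sqint (f_ k)) -> (forall k, sqint (G_ k)) -> sqint f -> sqint G ->
  L2cvg Omega f_ f -> L2cvg Omega G_ G -> (forall k, smooth_approx (f_ k) (G_ k)) ->
  smooth_approx f G.
Proof.
move=> qf_ qG_ qf qG cf cG ap.
have /choice[h hP] k : exists h, [/\ test_field h,
    ip (fun x => h x - f_ k x) (fun x => h x - f_ k x) <= k.+1%:R^-1 &
    ip (fun x => jacobian_field h x - G_ k x) (fun x => jacobian_field h x - G_ k x) <= k.+1%:R^-1].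
  have [h [th ch cJ]] := ap k.
  have k0 : (0 : R) < k.+1%:R^-1 by [].
  have [n _ nP] : \forall n \near \oo,
    ip (fun x => h n x - f_ k x) (fun x => h n x - f_ k x) <= k.+1%:R^-1 /\
    ip (fun x => jacobian_field (h n) x - G_ k x)
       (fun x => jacobian_field (h n) x - G_ k x) <= k.+1%:R^-1.
    move/cvgr0Pnorm_le : ch => /(_ _ k0) ch; move/cvgr0Pnorm_le : cJ => /(_ _ k0) cJ.
    near=> n; split; apply: le_trans (ler_norm _) _; near: n; assumption.
  by exists (h n); have [] := nP n (leqnn n).
have lim m n (H_ F_ : nat -> 'rV[R]_N -> 'M[R]_(m, n)) F : (forall k, sqint (H_ k)) ->
    (forall k, sqint (F_ k)) -> sqint F -> L2cvg Omega F_ F ->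
    (forall k, ip (fun x => H_ k x - F_ k x) (fun x => H_ k x - F_ k x) <= k.+1%:R^-1) ->
    L2cvg Omega H_ F.
  move=> qH qF_ qF cF HF.
  apply: (@squeeze_cvgr _ _ _ _ (fun=> 0) (fun k => 2 * k.+1%:R^-1 +
    2 * ip (fun x => F_ k x - F x) (fun x => F_ k x - F x))).
  - near=> k; rewrite inner_ge0/=.
    rewrite [leLHS](@eq_inner _ _ _ _ _ _ (fun x => 1 *: (H_ k x - F_ k x) + 1 *: (F_ k x - F x)) _
      (fun x => 1 *: (H_ k x - F_ k x) + 1 *: (F_ k x - F x))).
    + apply: le_trans (@inner_comb_le _ _ _ _ _ _ _ _ _ _ _ _) _ => //; try exact: sqintB.
      by rewrite expr1n !mulr1 lerD2r ler_pM2l.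
    + by move=> x _; rewrite !scale1r addrA subrK.
    + by move=> x _; rewrite !scale1r addrA subrK.
  - exact: cvg_cst.
  - rewrite -[X in _ --> X](addr0 0) -[X in _ --> X + _](mulr0 2) -[X in _ --> _ + X](mulr0 2).
    by apply: cvgD; apply: cvgM => //; [exact: cvg_cst|exact: cvg_harmonic|exact: cvg_cst].
exists h; split.
- by move=> k; have [] := hP k.
- by apply: lim cf _ => // k; have [] := hP k => // *; exact: sqint_test_field.
- by apply: lim cG _ => // k; have [] := hP k => // *; exact: sqint_jacobian.
Unshelve. all: by end_near. Qed.

End sobolev.

(** * Korn and Poincare inequalities *)

Section solenoidal.
Variables (R : realType) (N : nat) (Omega : set 'rV[R]_N).
Hypothesis mO : measurable Omega.
Hypothesis vO : (volume Omega < +oo)%E.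
Notation sqint := (square_integrable Omega).
Notation ip := (inner Omega).
Implicit Types y z : Y Omega.

Definition divfree (G : 'rV[R]_N -> 'M[R]_N) : Prop :=
  {ae volume, forall x, Omega x -> \tr (G x) = 0}.

Lemma Y_of f G : sqint f -> sqint G -> weak_gradient Omega f G -> divfree G ->
  smooth_approx Omega f G -> exists y : Y Omega, fld y = f /\ grad y = G.
Proof.
move=> qf qG /weak_gradientP w d ap.
pose h := @Build_H1 R N Omega f G qf qG w.
by exists (@Build_Y R N Omega h d ((vanishes_on_boundaryP mO vO h).2 ap)).
Qed.

Lemma Y_fld_sqint y : sqint y. Proof. exact: fld_sqint. Qed.
Lemma Y_grad_sqint y : sqint (grad y). Proof. exact: grad_sqint. Qed.
Hint Resolve Y_fld_sqint Y_grad_sqint : core.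

Lemma Y_weak y : weak_gradient Omega y (grad y).
Proof. by apply/weak_gradientP => phi tphi i j; exact: grad_weak. Qed.

Lemma Y_approx y : smooth_approx Omega y (grad y).
Proof. by apply/vanishes_on_boundaryP => //; exact: Y_boundary. Qed.

Lemma Y_comb a b y z : exists w : Y Omega,
  fld w = (fun x => a *: y x + b *: z x) /\
  grad w = (fun x => a *: grad y x + b *: grad z x).
Proof.
apply: Y_of.
- exact: sqint_comb.
- exact: sqint_comb.
- by apply: weak_gradient_comb => //; exact: Y_weak.
- apply: filterS2 (Y_divfree y) (Y_divfree z) => x ty tz Ox.
  by rewrite mxtraceD !mxtraceZ ty// tz// !mulr0 addr0.
- by apply: smooth_approx_comb => //; exact: Y_approx.
Qed.

Lemma frob_trace n (A : 'M[R]_n) c : frob A (c *: 1%:M) = c * \tr A.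
Proof.
rewrite frobZr; congr (_ * _); apply: eq_bigr => i _.
rewrite (bigD1 i)//= mxE eqxx mulr1 big1 ?addr0// => j /negPf ji.
by rewrite mxE eq_sym ji mulr0.
Qed.

Lemma sqr_mxtrace_le n (A : 'M[R]_n) : (\tr A) ^+ 2 <= n%:R * frob A A.
Proof.
have := frob_CS A (1 *: 1%:M); rewrite frob_trace mul1r mulrC.
by rewrite frob_trace mul1r scale1r mxtrace1.
Qed.

Lemma sqint_measurable_le m n p q (F : 'rV[R]_N -> 'M[R]_(m, n)) (G : 'rV[R]_N -> 'M[R]_(p, q)) C :
  measurable_fun Omega F -> sqint G ->
  (forall x, Omega x -> frob (F x) (F x) <= C * frob (G x) (G x)) -> sqint F.
Proof.
move=> mF [mG iG] FG; split => //.
apply: (@le_lt_trans _ _ (\int[volume]_(x in Omega) (`|C|%:E * (frob (G x) (G x))%:E))%E).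
  apply: ge0_le_integral => //.
  - by move=> x _; rewrite lee_fin frob_ge0.
  - by apply/measurable_EFinP; exact: measurable_frob.
  - by apply/measurable_EFinP; apply: measurable_funM => //; exact: measurable_frob.
  - move=> x Ox; rewrite -EFinM lee_fin (le_trans (FG x Ox))//.
    by rewrite ler_wpM2r ?frob_ge0// ler_norm.
rewrite ge0_integralZl_EFin// ?lte_mul_pinfty//.
- by move=> x _; rewrite lee_fin frob_ge0.
- by apply/measurable_EFinP; exact: measurable_frob.
Qed.

Lemma sqint_trace p (B : 'M[R]_p) (G : 'rV[R]_N -> 'M[R]_N) :
  sqint G -> sqint (fun x => \tr (G x) *: B).
Proof.
move=> qG; apply: (@sqint_measurable_le _ _ _ _ _ G (N%:R * frob B B)) => //.
  apply: measurable_mxZ => //; have /measurable_mxP mG := sqint_measurable qG.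
  by apply: measurable_sum => i; exact: mG.
move=> x _; rewrite frobZl frobZr mulrA -expr2 [leRHS]mulrAC ler_wpM2r ?frob_ge0//.
exact: sqr_mxtrace_le.
Qed.

(** The squared trace of [G] integrates to the inner product of [G] with [tr G] times the identity.
    This inner product is the limit of those with [G_ k], all zero. The trace is viewed as a 1 by 1
    field so that [energy0_ae] applies. *)
Lemma divfree_lim (G_ : nat -> 'rV[R]_N -> 'M[R]_N) G :
  (forall k, sqint (G_ k)) -> sqint G -> L2cvg Omega G_ G ->
  (forall k, divfree (G_ k)) -> divfree G.
Proof.
move=> qG_ qG cG dG.
have qP : sqint (fun x => \tr (G x) *: (1%:M : 'M[R]_N)) by exact: sqint_trace.
have q1 : sqint (fun x => \tr (G x) *: (1%:M : 'M[R]_1)) by exact: sqint_trace.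
have : ip (fun x => \tr (G x) *: (1%:M : 'M[R]_1)) (fun x => \tr (G x) *: (1%:M : 'M[R]_1)) = 0.
  transitivity (ip G (fun x => \tr (G x) *: (1%:M : 'M[R]_N))).
    by apply: eq_Rintegral => x _; rewrite !frob_trace mxtraceZ mxtrace1 mulr1.
  have := cvg_inner mO qG_ qG qP cG.
  have -> : (fun k => ip (G_ k) (fun x => \tr (G x) *: (1%:M : 'M[R]_N))) = (fun=> 0).
    apply/funext => k; apply: inner_ae0 => //.
    by apply: filterS (dG k) => x H Ox; rewrite frob_trace H// mulr0.
  by move=> c; rewrite -(cvg_lim _ c)// lim_cst.
move/(energy0_ae mO q1); apply: filterS => x /[apply] /matrixP/(_ 0 0).
by rewrite !mxE mulr1.
Qed.

Lemma sqint_tr m n (G : 'rV[R]_N -> 'M[R]_(m, n)) : sqint G -> sqint (fun x => (G x)^T).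
Proof.
move=> qG; apply: (@sqint_measurable_le _ _ _ _ _ G 1) => //.
  apply/measurable_mxP => i j; under eq_fun do rewrite mxE.
  by have /measurable_mxP mG := sqint_measurable qG; exact: mG.
by move=> x _; rewrite frob_tr mul1r.
Qed.

(* For a test field [f], integrating by parts twice turns [int grad y : (D f)^T]
   into [int (div y) (div f)], which vanishes. *)
Lemma inner_grad_jacobian_tr y f : test_field Omega f ->
  ip (grad y) (fun x => (jacobian_field f x)^T) = 0.
Proof.
move=> tf; have tp i j := test_function_partial i (tf j).
have qs m n i j (B : 'M[R]_(m, n)) : sqint (fun x => partial i (fun x => f x 0 j) x *: B).
  exact: sqint_test_scale.
transitivity (ip (grad y) (fun x => \sum_(ij : 'I_N * 'I_N)
   partial ij.1 (fun x => f x 0 ij.2) x *: delta_mx ij.1 ij.2)).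
  apply: eq_inner => // x _; rewrite [LHS]matrix_sum_delta pair_bigA.
  by apply: eq_bigr => -[i j] _; rewrite !mxE.
rewrite inner_sumr//.
transitivity (\sum_(ij : 'I_N * 'I_N) ip (grad y)
    (fun x => partial ij.2 (fun x => f x 0 ij.2) x *: delta_mx ij.1 ij.1)).
  apply: eq_bigr => -[i j] _ /=; apply: oppr_inj.
  (* Both sides become integrals of [y_i] against a mixed second derivative of [f_j], in the two
     orders of differentiation; smoothness of [f_j] makes them agree. *)
  have /= <- := Y_weak y (tp i j) i j.
  have /= <- := Y_weak y (tp j j) i i.
  apply: eq_inner => [x _|x _]; first by [].
  by rewrite partialC//; have [] := tf j.
rewrite -inner_sumr//; apply: inner_ae0 => //; first exact: sqint_sum.
apply: filterS (Y_divfree y) => x ty Ox.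
rewrite -(pair_bigA _ (fun i j => partial j (fun x => f x 0 j) x *: delta_mx i i))/= exchange_big/=.
under eq_bigr do rewrite -scaler_sumr.
rewrite -scaler_suml (_ : \sum_i delta_mx i i = 1%:M :> 'M[R]_N) ?frob_trace ?ty ?mulr0//.
apply/matrixP => i j; rewrite summxE (bigD1 i)//= !mxE eqxx big1 ?addr0 1?eq_sym// => k ki.
by rewrite mxE eq_sym (negPf ki).
Qed.

(** Only one of the two factors is approximated by test fields; the other is handled through its
    weak gradient. *)
Lemma inner_grad_tr y : ip (grad y) (fun x => (grad y x)^T) = 0.
Proof.
have [f [tf _ cG]] := Y_approx y.
have qJ k : sqint (jacobian_field (f k)) by exact: sqint_jacobian.
have qT : sqint (fun x => (grad y x)^T) by exact: sqint_tr.
have := cvg_inner mO qJ (Y_grad_sqint y) qT cG.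
have -> : (fun k => ip (jacobian_field (f k)) (fun x => (grad y x)^T)) = (fun=> 0).
  apply/funext => k; rewrite -[RHS](inner_grad_jacobian_tr y (tf k)) innerC.
  by apply: eq_Rintegral => x _; rewrite -[LHS]frob_tr trmxK.
by move=> c; rewrite -(cvg_lim _ c)// lim_cst.
Qed.

Lemma sqint_strain y : sqint (strain y).
Proof.
rewrite /strain /sym_part; apply: sqintZ => //; apply: sqintD => //; exact: sqint_tr.
Qed.

(** In [|eps y|^2 = (|grad y|^2 + grad y : grad y^T) / 2] the mixed term integrates to zero, so
    Korn's inequality becomes an identity. *)
Lemma korn y : ip (grad y) (grad y) = 2 * ip (strain y) (strain y).
Proof.
have qT : sqint (fun x => (grad y x)^T) by exact: sqint_tr.
have -> : ip (strain y) (strain y) =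
    2^-1 * (ip (grad y) (grad y) + ip (grad y) (fun x => (grad y x)^T)).
  rewrite -innerDr// -innerZr//; last exact: sqintD.
  by apply: eq_Rintegral => x _; rewrite frob_sym_part frobZr frobDr.
by rewrite inner_grad_tr addr0 mulVKf.
Qed.

Variables (j : 'I_N) (M : R).
Hypothesis OmegaM : forall x, Omega x -> `|x 0 j| <= M.

Let coord_le x : Omega x -> x 0 j ^+ 2 <= M ^+ 2.
Proof.
move=> /OmegaM xM; rewrite -[leLHS]real_normK ?num_real// ler_sqr ?nnegrE//.
exact: le_trans xM.
Qed.

(* Testing the weak gradient against [x_j f_i] and letting the field [f] tend to
   [y] yields [|y|^2 = -2 int x_j y . (d_j y)]. *)
Lemma poincare y : ip y y <= 4 * M ^+ 2 * ip (grad y) (grad y).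
Proof.
(* [K] is [x_j d_j y], and [L] carries [x_j y] in its column [j], so pairing a Jacobian with [L]
   gives [x_j y . d_j f]. *)
pose K (x : 'rV[R]_N) : 'rV[R]_N := \row_i (x 0 j * grad y x i j).
pose L (x : 'rV[R]_N) : 'M[R]_N := \matrix_(i, l) (x 0 j * y x 0 i * (l == j)%:R).
have /measurable_mxP my := sqint_measurable (Y_fld_sqint y).
have /measurable_mxP mG := sqint_measurable (Y_grad_sqint y).
have mx : measurable_fun Omega (fun x : 'rV[R]_N => x 0 j).
  by apply: measurable_funS (measurable_mx_coord 0 j).
have frobL (A : 'M[R]_N) x : frob A (L x) = x 0 j * \sum_i A i j * y x 0 i.
  rewrite mulr_sumr; apply: eq_bigr => i _; rewrite (bigD1 j)//= mxE eqxx mulr1 big1 ?addr0.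
    by rewrite mulrCA.
  by move=> l /negPf lj; rewrite mxE lj !mulr0.
have KK x : frob (K x) (K x) = x 0 j ^+ 2 * \sum_i grad y x i j ^+ 2.
  rewrite /frob big_ord1 mulr_sumr; apply: eq_bigr => i _.
  by rewrite !mxE -expr2 exprMn.
have KKle x : Omega x -> frob (K x) (K x) <= frob (M *: grad y x) (M *: grad y x).
  move=> Ox; rewrite KK frobZl frobZr mulrA -expr2 ler_pM ?sqr_ge0 ?coord_le//.
    by apply: sumr_ge0 => i _; exact: sqr_ge0.
  apply: ler_sum => i _; rewrite (bigD1 j)//= expr2 lerDl.
  by apply: sumr_ge0 => l _; rewrite -expr2 sqr_ge0.
have mK : measurable_fun Omega K.
  apply/measurable_mxP => i l; under eq_fun do rewrite mxE.
  by apply: measurable_funM.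
have qK : sqint K.
  apply: (@sqint_measurable_le _ _ _ _ K (grad y) (M ^+ 2)) => // x Ox.
  by have := KKle x Ox; rewrite frobZl frobZr mulrA -expr2.
have qL : sqint L.
  apply: (@sqint_measurable_le _ _ _ _ L (fld y) (M ^+ 2)) => //.
    apply/measurable_mxP => i l; under eq_fun do rewrite mxE.
    by do 2 apply: measurable_funM => //.
  move=> x Ox; rewrite frobL.
  have -> : x 0 j * \sum_i L x i j * y x 0 i = x 0 j ^+ 2 * frob (y x) (y x).
    rewrite expr2 -mulrA; congr (_ * _); rewrite /frob big_ord1 mulr_sumr; apply: eq_bigr => i _.
    by rewrite mxE eqxx mulr1 mulrA.
  by rewrite ler_wpM2r ?frob_ge0 ?coord_le.
have [f [tf cf cG]] := Y_approx y.
have qf k : sqint (f k) by exact: sqint_test_field.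
have qJ k : sqint (jacobian_field (f k)) by exact: sqint_jacobian.
have test k : ip (f k) y + ip (jacobian_field (f k)) L = - ip (f k) K.
  have tx i := test_function_coordM j (tf k i).
  have qx i (B : 'M[R]_N) := sqint_test_scale mO vO B (tx i).
  have qd i (B : 'rV[R]_N) := sqint_test_scale mO vO B (test_function_partial j (tx i)).
  transitivity (ip y (fun x => \sum_i partial j (fun x => x 0 j * f k x 0 i) x *: delta_mx 0 i)).
    rewrite -RintegralD//; [|exact: integrable_frob|exact: integrable_frob].
    apply: eq_Rintegral => x _.
    have -> : frob (y x) (\sum_i partial j (fun x => x 0 j * f k x 0 i) x *: delta_mx 0 i) =
       \sum_i partial j (fun x => x 0 j * f k x 0 i) x * y x 0 i.
      rewrite [RHS](_ : _ = frob (y x) (\row_i partial j (fun x => x 0 j * f k x 0 i) x)).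
        by congr (frob _ _); rewrite [RHS]row_sum_delta; apply: eq_bigr => i _; rewrite mxE.
      by rewrite /frob big_ord1; apply: eq_bigr => i _; rewrite mxE mulrC.
    rewrite frobL /frob big_ord1 mulr_sumr -big_split; apply: eq_bigr => i _ /=.
    rewrite partial_coordM ?eqxx ?mxE; last by apply: smooth_differentiable; case: (tf k i).
    by rewrite mul1r mulrDl mulrA.
  rewrite inner_sumr//; under eq_bigr do rewrite (Y_weak y)//.
  rewrite sumrN -inner_sumr//; congr (- _); apply: eq_Rintegral => x _.
  have -> : \sum_i (x 0 j * f k x 0 i) *: delta_mx i j =
      (\matrix_(i, l) (x 0 j * f k x 0 i * (l == j)%:R) : 'M[R]_N).
    apply/matrixP => i l; rewrite summxE (bigD1 i)//= !mxE eqxx big1 ?addr0//.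
    by move=> i' /negPf ii; rewrite !mxE eq_sym ii mulr0.
  rewrite /frob big_ord1; apply: eq_bigr => i _.
  rewrite (bigD1 j)//= !mxE eqxx mulr1 big1 ?addr0; first by ring.
  by move=> l /negPf lj; rewrite mxE lj !mulr0.
have lim : ip y y + ip (grad y) L = - ip y K.
  have c1 := cvg_inner mO qf (Y_fld_sqint y) (Y_fld_sqint y) cf.
  have c2 := cvg_inner mO qJ (Y_grad_sqint y) qL cG.
  have c3 := cvg_inner mO qf (Y_fld_sqint y) qK cf.
  have cl : ip (f k) y + ip (jacobian_field (f k)) L @[k --> \oo] --> ip y y + ip (grad y) L.
    exact: cvgD.
  have cr : - ip (f k) K @[k --> \oo] --> - ip y K by exact: cvgN.
  rewrite -(cvg_lim _ cl)// -(cvg_lim _ cr)//; congr (limn _).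
  by apply/funext => k; exact: test.
have GL : ip (grad y) L = ip y K.
  apply: eq_Rintegral => x _; rewrite frobL /frob big_ord1 mulr_sumr.
  by apply: eq_bigr => i _; rewrite mxE; ring.
(* Since [|y|^2 = -2 ip y K], Young's inequality for [y] and [-2 K] reads
   [2 |y|^2 <= |y|^2 + 4 |K|^2]. *)
have := inner_young mO (Y_fld_sqint y) (sqintZ mO (-2) qK).
rewrite innerZr// innerZl//; last exact: sqintZ.
rewrite innerZr// => H.
have KM : ip K K <= M ^+ 2 * ip (grad y) (grad y).
  have qM := sqintZ mO M (Y_grad_sqint y).
  rewrite expr2 -mulrA -innerZr// -innerZl//.
  by apply: le_Rintegral => //; exact: integrable_frob.
have y2 : ip y y = - 2 * ip y K by move: lim; rewrite GL; lra.
by move: H; rewrite y2; lra.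
Qed.

End solenoidal.

(** * The plasticity law acting on square-integrable fields *)

Section plasticity_operators.
Variables (R : realType) (N : nat) (Omega : set 'rV[R]_N) (g : R).
Hypothesis mO : measurable Omega.
Hypothesis g_gt0 : 0 < g.
Notation sqint := (square_integrable Omega).
Notation ip := (inner Omega).
Implicit Types E H V : 'rV[R]_N -> 'M[R]_N.

Lemma measurable_plast E : measurable_fun Omega E -> measurable_fun Omega (fun x => plast g (E x)).
Proof.
move=> mE; under eq_fun do rewrite plastE.
apply: measurable_mxZ => //.
have mN : measurable_fun Omega (fun x => frob_norm (E x)).
  apply: (@measurableT_comp _ _ _ _ _ _ (@Num.sqrt R)); last exact: measurable_frob.
  by apply: continuous_measurable_fun; exact: sqrt_continuous.
apply: measurable_funM.
  by apply: measurable_maxr => //; exact: measurable_funB.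
(* The inverse is discontinuous at [0]; as a real power with exponent [-1] it is a measurable
   function. *)
under eq_fun do rewrite -(powR_inv1 (frob_norm_ge0 _)).
by apply: (@measurableT_comp _ _ _ _ _ _ (fun y : R => y `^ (-1))).
Qed.

Definition plast_quotient E H (t : R) (x : 'rV[R]_N) : 'M[R]_N :=
  t^-1 *: (plast g (E x + t *: H x) - plast g (E x)).

Lemma measurable_plast_quotient E H t : measurable_fun Omega E -> measurable_fun Omega H ->
  measurable_fun Omega (plast_quotient E H t).
Proof.
move=> mE mH; apply: measurable_mxZ => //.
under eq_fun do rewrite -[- plast _ _]scaleN1r.
apply: measurable_mxD; last by apply: measurable_mxZ => //; exact: measurable_plast.
by apply: measurable_plast; apply: measurable_mxD => //; exact: measurable_mxZ.
Qed.

Lemma sqint_plast_quotient E H t : 0 < t -> measurable_fun Omega E -> sqint H ->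
  sqint (plast_quotient E H t).
Proof.
move=> t0 mE qH; have [mH _] := qH.
apply: sqint_le qH _ => //; first exact: measurable_plast_quotient.
by move=> x _; exact: plast_quotient_le.
Qed.

Let cvg_seq E H (u : nat -> R) x : (forall k, 0 < u k) -> u @ \oo --> 0 ->
  plast_quotient E H (u k) x @[k --> \oo] --> dplast g (E x) (H x).
Proof.
move=> u0 uc; have := cvg_plast_quotient g_gt0 (E := E x) (H := H x).
apply: cvg_comp => A /=; rewrite /at_right /within /= => nA.
near=> k; have : 0 < u k -> A (u k) by near: k; exact: (uc _ nA).
by apply.
Unshelve. all: by end_near. Qed.

(** Measurability comes from the pointwise limit of the quotients at [t = 1 / (k + 1)], which
    bypasses the case distinction in [dplast]. *)
Lemma measurable_dplast E H : measurable_fun Omega E -> measurable_fun Omega H ->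
  measurable_fun Omega (fun x => dplast g (E x) (H x)).
Proof.
move=> mE mH; apply/measurable_mxP => i j.
apply: (@measurable_fun_cvg _ _ _ _ (fun k x => plast_quotient E H k.+1%:R^-1 x i j)) => [k|x _].
  by have /measurable_mxP := measurable_plast_quotient k.+1%:R^-1 mE mH; exact.
by apply: cvg_coord; apply: cvg_seq => //; exact: cvg_harmonic.
Qed.

Lemma sqint_dplast E H : measurable_fun Omega E -> sqint H ->
  sqint (fun x => dplast g (E x) (H x)).
Proof.
move=> mE qH; have [mH _] := qH; apply: sqint_le qH _ => //; first exact: measurable_dplast.
by move=> x _; exact: frob_dplast_le.
Qed.

Lemma sqint_plast E : sqint E -> sqint (fun x => plast g (E x)).
Proof.
move=> qE; have [mE _] := qE; apply: sqint_le qE _ => //; first exact: measurable_plast.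
by move=> x _; have := plast_lipschitz g_gt0 (E x) 0; rewrite plast0// !subr0.
Qed.

Lemma plast_quotient_cvg E H : measurable_fun Omega E -> sqint H ->
  ip (fun x => plast_quotient E H t x - dplast g (E x) (H x))
     (fun x => plast_quotient E H t x - dplast g (E x) (H x)) @[t --> 0^'+] --> 0.
Proof.
move=> mE qH; apply/cvg_at_rightP => u [u0 uc].
have [mH iH] := qH.
pose f k x := (frob (plast_quotient E H (u k) x - dplast g (E x) (H x))
                    (plast_quotient E H (u k) x - dplast g (E x) (H x)))%:E.
have mf k : measurable_fun Omega (f k).
  by apply/measurable_EFinP; apply: measurable_frob; apply: sqint_measurable;
    apply: sqintB => //; (exact: sqint_plast_quotient || exact: sqint_dplast).
suff : (\int[volume]_(x in Omega) f k x @[k --> \oo] --> \int[volume]_(x in Omega) (cst 0%E x))%E.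
  by rewrite integral0 => /fine_cvg.
(* The quotient and its limit are each bounded by [|H|] in norm, so their squared distance is at
   most [2 |H|^2 + 2 |H|^2]. *)
apply: (@dominated_cvg _ _ _ volume _ mO f _ (fun x => (4%:E * (frob (H x) (H x))%:E)%E)) => //.
- move=> x _; apply: cvg_EFin; first by near=> k.
  have c : plast_quotient E H (u k) x - dplast g (E x) (H x) @[k --> \oo] --> (0 : 'M[R]_N).
    rewrite -(subrr (dplast g (E x) (H x))); apply: cvgB; last exact: cvg_cst.
    exact: cvg_seq.
  by rewrite -[X in _ --> X](frob0l (0 : 'M[R]_N)); exact: cvg_frob.
- by apply: integrableZl => //; exact: integrable_frob.
- move=> k x _; rewrite /f gee0_abs ?lee_fin ?frob_ge0//.
  apply: le_trans (frobB_le _ _) _.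
  have := plast_quotient_le g_gt0 (E x) (H x) (u0 k).
  have := frob_dplast_le (E x) (H x) g_gt0.
  by rewrite /plast_quotient; lra.
Unshelve. all: by end_near. Qed.

End plasticity_operators.

(** * The linearized problem *)

Section linearized_problem.
Variables (R : realType) (N : nat) (Omega : set 'rV[R]_N).
Hypothesis mO : measurable Omega.
Hypothesis vO : (volume Omega < +oo)%E.
Variables (j : 'I_N) (M : R).
Hypothesis OmegaM : forall x, Omega x -> `|x 0 j| <= M.
Notation sqint := (square_integrable Omega).
Notation ip := (inner Omega).
Implicit Types y z v w : Y Omega.

Let qfld y : sqint y. Proof. exact: fld_sqint. Qed.
Let qgrad y : sqint (grad y). Proof. exact: grad_sqint. Qed.
Let qstrain y : sqint (strain y). Proof. exact: sqint_strain. Qed.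
Hint Resolve qfld qgrad qstrain : core.

Let strain_comb a b y z w : grad w = (fun x => a *: grad y x + b *: grad z x) ->
  strain w = (fun x => a *: strain y x + b *: strain z x).
Proof.
move=> gw; apply/funext => x; rewrite /strain /sym_part gw.
by apply/matrixP => i l; rewrite !mxE; ring.
Qed.

Lemma Y_sub y z : exists w : Y Omega, [/\ fld w = (fun x => y x - z x),
  grad w = (fun x => grad y x - grad z x) & strain w = (fun x => strain y x - strain z x)].
Proof.
have [w [wf wg]] := Y_comb mO vO 1 (-1) y z; exists w; split.
- by rewrite wf; apply/funext => x; rewrite scale1r scaleN1r.
- by rewrite wg; apply/funext => x; rewrite scale1r scaleN1r.
- by rewrite (strain_comb wg); apply/funext => x; rewrite scale1r scaleN1r.
Qed.

Lemma Y_addZ y s v : exists w : Y Omega, [/\ fld w = (fun x => y x + s *: v x),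
  grad w = (fun x => grad y x + s *: grad v x) &
  strain w = (fun x => strain y x + s *: strain v x)].
Proof.
have [w [wf wg]] := Y_comb mO vO 1 s y v; exists w; split.
- by rewrite wf; apply/funext => x; rewrite scale1r.
- by rewrite wg; apply/funext => x; rewrite scale1r.
- by rewrite (strain_comb wg); apply/funext => x; rewrite scale1r.
Qed.

Let fld_le y : ip y y <= 8 * M ^+ 2 * ip (strain y) (strain y).
Proof. by apply: le_trans (poincare mO vO OmegaM y) _; rewrite (korn mO vO); lra. Qed.

(** Strains control fields and gradients, so both sequences converge in [L^2]; weak gradient,
    divergence and boundary condition are each closed under such limits. *)
Lemma Y_complete (z_ : nat -> Y Omega) :
  (forall e, 0 < e -> exists K, forall k l, (K <= k)%N -> (K <= l)%N ->
    ip (fun x => strain (z_ k) x - strain (z_ l) x)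
       (fun x => strain (z_ k) x - strain (z_ l) x) <= e) ->
  exists w : Y Omega, L2cvg Omega z_ w /\ L2cvg Omega (fun k => strain (z_ k)) (strain w).
Proof.
move=> cz.
have cauchy m n (F_ : Y Omega -> 'rV[R]_N -> 'M[R]_(m, n)) C :
    (forall y, sqint (F_ y)) -> 0 <= C ->
    (forall y z w, fld w = (fun x => y x - z x) -> grad w = (fun x => grad y x - grad z x) ->
       F_ w = (fun x => F_ y x - F_ z x)) ->
    (forall y, ip (F_ y) (F_ y) <= C * ip (strain y) (strain y)) ->
    exists2 F, sqint F & L2cvg Omega (fun k => F_ (z_ k)) F.
  move=> qF C0 lF FC; apply: L2cvg_complete => // e e0.
  have [|K KP] := cz (e / (C + 1)); first by rewrite divr_gt0// ltr_wpDl.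
  exists K => k l Kk Kl; have [w [wf wg ws]] := Y_sub (z_ k) (z_ l).
  rewrite -(lF _ _ _ wf wg); apply: le_trans (FC w) _; rewrite ws.
  apply: (@le_trans _ _ ((C + 1) * (e / (C + 1)))); last first.
    by rewrite mulrCA divff ?mulr1// lt0r_neq0// ltr_wpDl.
  apply: ler_pM; [by []|exact: inner_ge0|by rewrite lerDl|exact: KP].
have [f qf cf] : exists2 f, sqint f & L2cvg Omega z_ f.
  apply: (cauchy _ _ (fun y => fld y) (8 * M ^+ 2)) => //.
  by rewrite mulr_ge0// sqr_ge0.
have [G qG cG] : exists2 G, sqint G & L2cvg Omega (fun k => grad (z_ k)) G.
  apply: (cauchy _ _ (fun y => grad y) 2) => // y.
  by rewrite (korn mO vO).
have [w [wf wg]] : exists w : Y Omega, fld w = f /\ grad w = G.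
  apply: (Y_of mO vO) => //.
  - by apply: weak_gradient_lim cf cG _ => // k; exact: Y_weak.
  - by apply: divfree_lim cG _ => // k; exact: Y_divfree.
  - by apply: smooth_approx_lim cf cG _ => // k; exact: Y_approx.
exists w; split; first by rewrite wf.
rewrite -wg in cG.
apply: (@squeeze_cvgr _ _ _ _ (fun=> 0) _ _ _ _ _ cG); last exact: cvg_cst.
near=> k; rewrite inner_ge0/=; have [v [_ vg vs]] := Y_sub (z_ k) w.
rewrite -vs -vg (korn mO vO); have := inner_ge0 Omega (strain v); lra.
Unshelve. all: by end_near. Qed.

Variables (mu nu g : R) (E : 'rV[R]_N -> 'M[R]_N) (h : 'rV[R]_N -> 'rV[R]_N).
Hypotheses (mu_gt0 : 0 < mu) (nu_ge0 : 0 <= nu) (g_gt0 : 0 < g).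
Hypotheses (mE : measurable_fun Omega E) (qh : sqint h).

Let D (H : 'rV[R]_N -> 'M[R]_N) (x : 'rV[R]_N) := dplast g (E x) (H x).

Let qD H : sqint H -> sqint (D H).
Proof. exact: sqint_dplast. Qed.

Let J z := mu / 2 * ip (strain z) (strain z) + nu / 2 * ip (D (strain z)) (strain z) - ip h z.

Let DJ z v := mu * ip (strain z) (strain v) + nu * ip (D (strain z)) (strain v) - ip h v.

(** Twice the integrated pointwise expansion of the energy, whence the factor [3]. The outer bounds
    are gathered into inner products with [Z + 2 s V] and [3 s V], so that the integrals compare
    pointwise. *)
Let D_expansion Z V s : sqint Z -> sqint V ->
  2 * s * ip (D Z) V + ip (D Z) Z <=
    ip (D (fun x => Z x + s *: V x)) (fun x => Z x + s *: V x) <=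
  2 * s * ip (D Z) V + ip (D Z) Z + 3 * s ^+ 2 * ip V V.
Proof.
move=> qZ qV; have qsV := sqintZ mO s qV; have q2 := sqintZ mO 2 qsV.
have q3 := sqintZ mO 3 qsV.
have qW := sqintD mO qZ qsV; have qZ2 := sqintD mO qZ q2.
have qDZ := qD qZ; have qDW := qD qW.
have e1 : ip (D Z) (fun x => Z x + 2 *: (s *: V x)) = 2 * s * ip (D Z) V + ip (D Z) Z.
  rewrite (innerDr mO qZ q2 qDZ) (innerZr mO _ qsV qDZ) (innerZr mO _ qV qDZ); ring.
have e2 : ip (fun x => 3 *: (s *: V x)) (fun x => s *: V x) = 3 * s ^+ 2 * ip V V.
  rewrite (innerZl mO _ qsV qsV) (innerZl mO _ qV qsV) (innerZr mO _ qV qV); ring.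
rewrite -e1 -e2 -RintegralD//; last 2 first.
- exact: integrable_frob.
- exact: integrable_frob.
apply/andP; split; apply: le_Rintegral => //.
- exact: integrable_frob.
- exact: integrable_frob.
- move=> x _; have /andP[+ _] := dplast_energy_expansion g_gt0 (E x) (Z x) (s *: V x).
  rewrite /dplast_energy /D; move: (dplast g (E x) (Z x + s *: V x)) (dplast g (E x) (Z x)) => P Q.
  by rewrite (frobDr Q) (frobZr 2 Q); lra.
- exact: integrable_frob.
- exact: (integrableD mO (integrable_frob mO qDZ qZ2) (integrable_frob mO q3 qsV)).
- move=> x _; have /andP[_ +] := dplast_energy_expansion g_gt0 (E x) (Z x) (s *: V x).
  rewrite /dplast_energy /D; move: (dplast g (E x) (Z x + s *: V x)) (dplast g (E x) (Z x)) => P Q.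
  by rewrite (frobDr Q) (frobZr 2 Q) (frobZl 3); lra.
Qed.

(** The [mu] term is expanded exactly and alone supplies the strong convexity; the [nu] term adds a
    remainder between [0] and [3 / 2 * nu * s^2 |eps v|^2]. *)
Let J_expansion z v w s : fld w = (fun x => z x + s *: v x) ->
  strain w = (fun x => strain z x + s *: strain v x) ->
  mu / 2 * s ^+ 2 * ip (strain v) (strain v) <= J w - J z - s * DJ z v
   <= (mu / 2 + 3 / 2 * nu) * s ^+ 2 * ip (strain v) (strain v).
Proof.
have arith (zz zv vv hz hv a b c : R) : nu * (2 * s * c + b) <= nu * a ->
    nu * a <= nu * (2 * s * c + b + 3 * s ^+ 2 * vv) ->
    mu / 2 * s ^+ 2 * vv <= mu / 2 * (zz + 2 * s * zv + s ^+ 2 * vv) + nu / 2 * a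
      - (hz + s * hv) - (mu / 2 * zz + nu / 2 * b - hz) - s * (mu * zv + nu * c - hv)
      <= (mu / 2 + 3 / 2 * nu) * s ^+ 2 * vv.
  by move=> ? ?; apply/andP; split; lra.
move=> wf ws.
have hw : ip h w = ip h z + s * ip h v.
  by rewrite wf (innerDr mO (qfld z) (sqintZ mO s (qfld v)) qh) (innerZr mO _ (qfld v) qh).
have sw : ip (strain w) (strain w) = ip (strain z) (strain z) +
    2 * s * ip (strain z) (strain v) + s ^+ 2 * ip (strain v) (strain v).
  by rewrite ws (inner_sqrDZ mO s (qstrain z) (qstrain v)).
have /andP[lo hi] := D_expansion s (qstrain z) (qstrain v); rewrite -ws in lo hi.
by rewrite /J /DJ hw sw; apply: arith; exact: ler_wpM2l.
Qed.

Let J_bounded_below : exists B, forall z, B <= J z.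
Proof.
(* [C] bounds [|z|^2] by [C |eps z|^2], by the Poincare inequality and Korn's identity; the added
   [1] makes it positive. *)
pose C := 8 * M ^+ 2 + 1; have C0 : 0 < C by rewrite ltr_wpDl// mulr_ge0 ?sqr_ge0.
exists (- (C / (2 * mu) * ip h h)) => z.
(* With the weight [C / mu], Young's inequality becomes [2 ip h z <= (C / mu) |h|^2 + mu |eps z|^2],
   whose last term is absorbed by the quadratic part of [J]. *)
have qch : sqint (fun x => (C / mu) *: h x) by exact: sqintZ.
have := inner_young mO qch (qfld z); rewrite !innerZl ?innerZr//.
have zz : ip z z <= C * ip (strain z) (strain z).
  apply: le_trans (fld_le z) _; have := inner_ge0 Omega (strain z).
  by rewrite /C; move: (ip (strain z) (strain z)) => e; lra.
have Dz : 0 <= ip (D (strain z)) (strain z).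
  apply: inner_monotone => x _.
  have /andP[+ _] := dplast_energy_expansion g_gt0 (E x) 0 (strain z x).
  rewrite /dplast_energy /D add0r dplast0 !frob0l; lra.
move=> H.
have : C / mu * (2 * ip h z) <= C / mu * (C / mu * ip h h + mu * ip (strain z) (strain z)).
  apply: (@le_trans _ _ (C / mu * (C / mu * ip h h) + ip z z)); first by lra.
  by rewrite mulrDr lerD2l; apply: le_trans zz _; rewrite mulrA divfK// lt0r_neq0.
rewrite ler_pM2l ?divr_gt0// => {}H.
have -> : C / (2 * mu) = 2^-1 * (C / mu) by field; rewrite lt0r_neq0.
have := mulr_ge0 nu_ge0 Dz; rewrite /J; lra.
Qed.

Let DJ0 z : (forall w, J z <= J w) -> forall v, DJ z v = 0.
Proof.
move=> min v; set K := (mu / 2 + 3 / 2 * nu) * ip (strain v) (strain v).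
have K0 : 0 <= K.
  apply: mulr_ge0; last exact: inner_ge0.
  by move: (ltW mu_gt0) nu_ge0; lra.
have pos s : 0 <= s * DJ z v + K * s ^+ 2.
  have [w [wf _ ws]] := Y_addZ z s v; have /andP[_ H] := J_expansion wf ws.
  by have := min w; move: H; rewrite /K; lra.
apply/eqP; apply/negPn/negP => d0.
(* At this [s] the nonnegative expression would equal [- DJ z v ^+ 2 / (K + 1) ^+ 2]; using [K + 1]
   avoids the case [K = 0]. *)
have := pos (- DJ z v / (K + 1)).
have K1 : 0 < K + 1 by rewrite ltr_wpDl.
have -> : - DJ z v / (K + 1) * DJ z v + K * (- DJ z v / (K + 1)) ^+ 2 =
    - (DJ z v ^+ 2) / (K + 1) ^+ 2 by field; rewrite lt0r_neq0.
apply/negP; rewrite -ltNge mulNr oppr_lt0; apply: divr_gt0; last exact: exprn_gt0.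
by rewrite exprn_even_gt0.
Qed.

(* Strong convexity makes every minimizing sequence of [J] a Cauchy sequence. *)
Let J_min y0 : exists z, forall w, J z <= J w.
Proof.
have arith (a b c d e f : R) : mu * (a - b) + nu * (c - d) - (e - f) =
    mu * a + nu * c - e - (mu * b + nu * d - f) by ring.
have [B BJ] := J_bounded_below.
pose V := [set J z | z in [set: Y Omega]].
have iV : has_inf V by split; [exists (J y0), y0|exists B => _ [z _ <-]].
have infJ z : inf V <= J z by apply: ge_inf; [case: iV|exists z].
have /choice[z_ zP] k : exists z, J z <= inf V + k.+1%:R^-1.
  have k0 : (0 : R) < k.+1%:R^-1 by [].
  have [_ [z _ <-] /ltW zk] := inf_adherent k0 iV.
  by exists z.
have [z [cz cs]] : exists z : Y Omega,
    L2cvg Omega z_ z /\ L2cvg Omega (fun k => strain (z_ k)) (strain z).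
  apply: Y_complete => e e0.
  have [K _ KP] : \forall k \near \oo, 8 / mu * k.+1%:R^-1 < e.
    near=> k; rewrite ltr_pdivrMr// -ltr_pdivrMl//.
    by rewrite (lt_le_trans (y := k%:R))// ?ler_nat//; near: k; exact: nbhs_infty_gtr.
  exists K => k l Kk Kl.
  have [v [vf _ vs]] := Y_sub (z_ k) (z_ l).
  (* Expanding at the midpoint [c] with steps [1/2] and [-1/2] cancels [DJ c v], leaving [mu / 4
     |eps v|^2 <= J (z_ k) + J (z_ l) - 2 J c <= 2 / (K + 1)]; this explains [8 / mu] above. *)
  have [c [cf _ cs]] := Y_addZ (z_ l) 2^-1 v.
  have e1f : fld (z_ k) = (fun x => c x + 2^-1 *: v x).
    by apply/funext => x; rewrite cf vf -addrA -scalerDl -[2^-1]div1r -splitr scale1r addrC subrK.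
  have e1s : strain (z_ k) = (fun x => strain c x + 2^-1 *: strain v x).
    by apply/funext => x; rewrite cs vs -addrA -scalerDl -[2^-1]div1r -splitr scale1r addrC subrK.
  have e2f : fld (z_ l) = (fun x => c x + (- 2^-1) *: v x).
    by apply/funext => x; rewrite cf scaleNr addrK.
  have e2s : strain (z_ l) = (fun x => strain c x + (- 2^-1) *: strain v x).
    by apply/funext => x; rewrite cs scaleNr addrK.
  have /andP[H1 _] := J_expansion e1f e1s.
  have /andP[H2 _] := J_expansion e2f e2s.
  rewrite -vs.
  have inv n : (K <= n)%N -> n.+1%:R^-1 <= K.+1%:R^-1 :> R.
    by move=> Kn; rewrite lef_pV2 ?posrE// ler_nat ltnS.
  have {KP} KP := KP K (leqnn K).
  have := zP k; have := zP l; have := infJ c; have := inv _ Kk; have := inv _ Kl.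
  move=> i1 i2 i3 i4 i5.
  have : mu / 4 * ip (strain v) (strain v) <= 2 * K.+1%:R^-1.
    have q : (2^-1 : R) ^+ 2 = 4^-1 by field.
    rewrite sqrrN in H2; move: i1 i2 i3 i4 i5 H1 H2; rewrite q.
    move: (k.+1%:R^-1) (l.+1%:R^-1) (K.+1%:R^-1) => ? ? ?.
    by move: (J (z_ k)) (J (z_ l)) (J c) (DJ c v) (ip (strain v) (strain v)) (inf V) => *; lra.
  move=> H; apply: le_trans (ltW KP).
  rewrite -(ler_pM2l (divr_gt0 mu_gt0 (ltr0n _ 4))) (le_trans H)//.
  by rewrite le_eqVlt; apply/orP; left; apply/eqP; field; rewrite lt0r_neq0//= lt0r_neq0.
exists z => w; apply: le_trans (infJ w).
have cDJ : DJ z (z_ k) @[k --> \oo] --> DJ z z.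
  have c (m n : nat) (F : 'rV[R]_N -> 'M[R]_(m, n)) (G_ : nat -> 'rV[R]_N -> 'M[R]_(m, n)) G :
      sqint F -> (forall k, sqint (G_ k)) -> sqint G -> L2cvg Omega G_ G ->
      ip F (G_ k) @[k --> \oo] --> ip F G.
    move=> qF qG_ qG cG; rewrite innerC; under eq_fun do rewrite innerC.
    exact: cvg_inner.
  apply: cvgB; last exact: (c _ _ _ _ _ qh (fun k => qfld (z_ k)) (qfld z) cz).
  apply: cvgD; (apply: cvgM; first exact: cvg_cst).
    exact: (c _ _ _ _ _ (qstrain z) (fun k => qstrain (z_ k)) (qstrain z) cs).
  exact: (c _ _ _ _ _ (qD (qstrain z)) (fun k => qstrain (z_ k)) (qstrain z) cs).
(* Convexity places [J] above its tangent at [z]. Since [DJ z (z_ k)] tends to [DJ z z], this gives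
   lower semicontinuity along the sequence without any continuity of [J]. *)
have low k : J z <= inf V + k.+1%:R^-1 - DJ z (z_ k) + DJ z z.
  have [v [vf _ vs]] := Y_sub (z_ k) z.
  have zf : fld (z_ k) = (fun x => z x + 1 *: v x).
    by apply/funext => x; rewrite vf scale1r addrC subrK.
  have zs : strain (z_ k) = (fun x => strain z x + 1 *: strain v x).
    by apply/funext => x; rewrite vs scale1r addrC subrK.
  have /andP[H _] := J_expansion zf zs.
  have DJv : DJ z v = DJ z (z_ k) - DJ z z.
    rewrite /DJ vf vs (innerBr mO (qstrain (z_ k)) (qstrain z) (qstrain z)).
    rewrite (innerBr mO (qstrain (z_ k)) (qstrain z) (qD (qstrain z))).
    by rewrite (innerBr mO (qfld (z_ k)) (qfld z) qh) arith.
  have H0 : 0 <= mu / 2 * 1 ^+ 2 * ip (strain v) (strain v).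
    by rewrite expr1n mulr1 mulr_ge0 ?inner_ge0// divr_ge0// ltW.
  have := zP k; move: H0 H; rewrite DJv mul1r; move: (k.+1%:R^-1) (_ * ip _ _) => a b.
  by move: (J (z_ k)) (J z) (DJ z (z_ k)) (DJ z z) (inf V) => *; lra.
have cl : inf V + k.+1%:R^-1 - DJ z (z_ k) + DJ z z @[k --> \oo] --> inf V + 0 - DJ z z + DJ z z.
  apply: cvgD; last exact: cvg_cst.
  by apply: cvgB => //; apply: cvgD; [exact: cvg_cst|exact: cvg_harmonic].
rewrite addr0 subrK in cl.
by apply: (cvgr_to_ge cl); near=> k; exact: low.
Unshelve. all: by end_near. Qed.

(** The field [E] need only be measurable, since [|dplast g E H| <= |H|] whatever [E] is; [y0] shows
    that the infimum of [J] is over a nonempty set. *)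
Lemma linearized_solution (y0 : Y Omega) : exists z : Y Omega, forall v : Y Omega,
  mu * ip (strain z) (strain v) +
  nu * ip (fun x => dplast g (E x) (strain z x)) (strain v) = ip h v.
Proof.
have [z zmin] := J_min y0; exists z => v.
by apply/eqP; rewrite -subr_eq0; apply/eqP; exact: DJ0.
Qed.

End linearized_problem.

(** * Directional differentiability *)

Section sensitivity.
Variables (R : realType) (N : nat) (Omega : set 'rV[R]_N).
Hypothesis mO : measurable Omega.
Hypothesis vO : (volume Omega < +oo)%E.
Variables (j : 'I_N) (M : R).
Hypothesis OmegaM : forall x, Omega x -> `|x 0 j| <= M.
Notation sqint := (square_integrable Omega).
Notation ip := (inner Omega).
Variables (mu nu g : R).
Hypotheses (mu_gt0 : 0 < mu) (nu_ge0 : 0 <= nu) (g_gt0 : 0 < g).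
Implicit Types y z v w : Y Omega.

Let qfld y : sqint y. Proof. exact: fld_sqint. Qed.
Let qgrad y : sqint (grad y). Proof. exact: grad_sqint. Qed.
Let qstrain y : sqint (strain y). Proof. exact: sqint_strain. Qed.
Let mstrain y : measurable_fun Omega (strain y).
Proof. exact: sqint_measurable. Qed.

(** Sum of the two convexity inequalities of the energy, from [H1] towards [H2] and back. *)
Lemma dplast_monotone n (A H1 H2 : 'M[R]_n) :
  0 <= frob (dplast g A H1 - dplast g A H2) (H1 - H2).
Proof.
have /andP[+ _] := dplast_energy_expansion g_gt0 A H2 (H1 - H2).
have /andP[+ _] := dplast_energy_expansion g_gt0 A H1 (H2 - H1).
have -> : H1 + (H2 - H1) = H2 by rewrite addrC subrK.
have -> : H2 + (H1 - H2) = H1 by rewrite addrC subrK.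
have -> : H2 - H1 = - (H1 - H2) by rewrite opprB.
by move: (H1 - H2) (dplast g A H1) (dplast g A H2) => V P Q; rewrite !frobE; lra.
Qed.

Lemma linearized_equationP (y z : Y Omega) (h : 'rV[R]_N -> 'rV[R]_N) :
  linearized_equation mu nu g y h z <-> forall v : Y Omega,
  mu * ip (strain z) (strain v) +
  nu * ip (fun x => dplast g (strain y x) (strain z x)) (strain v) = ip h v.
Proof.
have e v : \int[volume]_(x in Omega) frob (plast' g (strain y x) (strain z x)) (strain v x) =
    ip (fun x => dplast g (strain y x) (strain z x)) (strain v).
  by apply: eq_Rintegral => x _; rewrite plast'E.
by split => H v; have := H v; rewrite e.
Qed.

(** Tested with [z' - z], the [nu] term of the difference is nonnegative by monotonicity, so the
    strain of the difference vanishes; gradient and field follow. *)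
Lemma linearized_equation_unique y h z z' :
  linearized_equation mu nu g y h z -> linearized_equation mu nu g y h z' -> H1_eq z' z.
Proof.
have arith (a a' b b' c : R) : mu * a + nu * b = c -> mu * a' + nu * b' = c ->
  mu * (a' - a) + nu * (b' - b) = 0 by move=> <-; lra.
move=> /linearized_equationP Hz /linearized_equationP Hz'.
have [w [wf wg ws]] := Y_sub mO vO z' z.
pose D v x := dplast g (strain y x) (strain v x).
have qD v : sqint (D v) by exact: sqint_dplast.
have mon : 0 <= ip (fun x => D z' x - D z x) (strain w).
  by rewrite ws; apply: inner_monotone => x _; exact: dplast_monotone.
have e : mu * ip (strain w) (strain w) + nu * ip (fun x => D z' x - D z x) (strain w) = 0.
  have ew : ip (strain w) (strain w) = ip (strain z') (strain w) - ip (strain z) (strain w).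
    by rewrite {1}ws (innerBl mO (qstrain z') (qstrain z) (qstrain w)).
  rewrite ew (innerBl mO (qD z') (qD z) (qstrain w)).
  exact: (arith _ _ _ _ _ (Hz w) (Hz' w)).
have w0 : ip (strain w) (strain w) = 0.
  apply/eqP; rewrite eq_le inner_ge0 andbT -(pmulr_rle0 _ mu_gt0).
  by have := mulr_ge0 nu_ge0 mon; lra.
have g0 : ip (grad w) (grad w) = 0 by rewrite (korn mO vO) w0 mulr0.
have f0 : ip w w = 0.
  apply/eqP; rewrite eq_le inner_ge0 andbT; apply: le_trans (poincare mO vO OmegaM w) _.
  by rewrite g0 mulr0.
have := energy0_ae mO (qgrad w) g0; have := energy0_ae mO (qfld w) f0.
apply: filterS2 => x fx gx Ox; move: (fx Ox) (gx Ox); rewrite wf wg.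
by move=> /eqP; rewrite subr_eq0 => /eqP -> /eqP; rewrite subr_eq0 => /eqP ->.
Qed.

Section derivative.
Variables (S : ('rV[R]_N -> 'rV[R]_N) -> Y Omega) (u h : 'rV[R]_N -> 'rV[R]_N) (z : Y Omega).
Hypothesis S_sol : forall u, sqint u -> state_equation mu nu g u (S u).
Hypotheses (qu : sqint u) (qh : sqint h).
Hypothesis z_sol : linearized_equation mu nu g (S u) h z.

Let Sut t := S (fun x => u x + t *: h x).
Let E := strain (S u).
Let P t x := plast_quotient g E (strain z) t x - dplast g (E x) (strain z x).

(** Makes [z_t - z] an admissible test function. All [t] are allowed, with [0^-1 = 0], because
    [cvg_H1_norm] asks for square integrability at each [t]. *)
Let remainder (t : R) : exists w : Y Omega, [/\
  fld w = (fun x => t^-1 *: (Sut t x - S u x) - z x),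
  grad w = (fun x => t^-1 *: (grad (Sut t) x - grad (S u) x) - grad z x) &
  strain w = (fun x => t^-1 *: (strain (Sut t) x - E x) - strain z x)].
Proof.
have [a [af ag as_]] := Y_sub mO vO (Sut t) (S u).
have [b [bf bg]] := Y_comb mO vO t^-1 (-1) a z; exists b; split.
- by rewrite bf af; apply/funext => x; rewrite scaleN1r.
- by rewrite bg ag; apply/funext => x; rewrite scaleN1r.
- apply/funext => x; rewrite /E /strain /sym_part bg ag.
  by apply/matrixP => i l; rewrite !mxE; ring.
Qed.

(* Monotonicity of the difference quotients reduces the estimate to the quotient
   at the fixed direction [strain z]. *)
Let remainder_le t w : 0 < t ->
  strain w = (fun x => t^-1 *: (strain (Sut t) x - E x) - strain z x) ->
  ip (strain w) (strain w) <= (nu / mu) ^+ 2 * ip (P t) (P t).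
Proof.
have balance_le (a b c d : R) : 0 <= nu * (a - b - c) -> mu * d + nu * (a - b) = 0 ->
  mu * d <= - nu * c by lra.
have absorb (k a b c : R) : 2 * (- k * a) <= - k * (- k * b) + c -> c <= - k * a ->
  c <= k ^+ 2 * b by lra.
move=> t0 ws; have tn0 : t != 0 by rewrite lt0r_neq0.
pose Q x := t^-1 *: (plast g (strain (Sut t) x) - plast g (E x)).
pose q x := plast_quotient g E (strain z) t x.
pose D x := dplast g (E x) (strain z x).
pose W x := strain w x.
have qW : sqint W by exact: qstrain.
have qE : sqint E by exact: qstrain.
have qpE : sqint (fun x => plast g (E x)) :=
  sqint_plast mO g_gt0 qE.
have qpS : sqint (fun x => plast g (strain (Sut t) x)) :=
  sqint_plast mO g_gt0 (qstrain (Sut t)).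
have qQ : sqint Q by apply: sqintZ => //; exact: sqintB.
have qq : sqint q := sqint_plast_quotient mO g_gt0 t0 (mstrain _) (qstrain _).
have qD : sqint D := sqint_dplast mO g_gt0 (mstrain _) (qstrain _).
have mon : 0 <= ip (fun x => Q x - q x) W.
  apply: inner_monotone => x _.
  (* By the definition of [W], the strain of the perturbed state is [E + t (W + strain z)], so [Q]
     is the difference quotient in the direction [W + strain z]. *)
  have -> : Q x = t^-1 *: (plast g (E x + t *: (W x + strain z x)) - plast g (E x)).
    rewrite /Q /W ws; congr (_ *: (plast g _ - _)).
    by rewrite subrK scalerA divff// scale1r addrC subrK.
  have -> : W x = W x + strain z x - strain z x by rewrite addrK.
  by rewrite {1}subrK; exact: plast_quotient_monotone.
have e1 := S_sol (sqintD mO qu (sqintZ mO t qh)) w.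
have e2 := S_sol qu w.
have e3 := (linearized_equationP _ _ _).1 z_sol w.
have eh : ip (fun x => u x + t *: h x) w = ip u w + t * ip h w.
  by rewrite (innerDl mO qu (sqintZ mO t qh) (qfld w)) (innerZl mO t qh (qfld w)).
have eQ : ip Q W = t^-1 *
    (ip (fun x => plast g (strain (Sut t) x)) W - ip (fun x => plast g (E x)) W).
  by rewrite /Q (innerZl mO _ (sqintB mO qpS qpE) qW) (innerBl mO qpS qpE qW).
have eW : ip W W = t^-1 * (ip (strain (Sut t)) W - ip E W) - ip (strain z) W.
  rewrite {1}/W ws (innerBl mO (sqintZ mO _ (sqintB mO (qstrain _) qE)) (qstrain z) qW).
  by rewrite (innerZl mO _ (sqintB mO (qstrain _) qE) qW) (innerBl mO (qstrain _) qE qW).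
(* The two state equations are subtracted and divided by [t], and the linearized equation is
   subtracted from the result; all right-hand sides cancel. *)
have bal : mu * ip W W + nu * (ip Q W - ip D W) = 0.
  move: e1 e2 e3; rewrite /state_equation.
  rewrite -![Rintegral _ _ _]/(ip _ _) -/(Sut t) -/E -/W -/D eh eW eQ.
  move: (ip (strain (Sut t)) W) (ip E W) (ip (strain z) W) => a b c.
  move: (ip (fun x => plast g (strain (Sut t) x)) W) (ip (fun x => plast g (E x)) W) => d e.
  move: (ip D W) => f.
  move: (ip u w) (ip h w) => k l H1 H2 H3.
  have -> : mu * (t^-1 * (a - b) - c) + nu * (t^-1 * (d - e) - f) =
      t^-1 * ((mu * a + nu * d) - (mu * b + nu * e)) - (mu * c + nu * f) by ring.
  by rewrite H1 H2 H3; field.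
have qP : sqint (P t) by exact: sqintB.
have QP : ip (fun x => Q x - q x) W = ip Q W - ip D W - ip (P t) W.
  rewrite (innerBl mO qQ qq qW) (innerBl mO qq qD qW : ip (P t) W = _).
  by move: (ip Q W) (ip q W) (ip D W); clear => a b c; ring.
(* The weight [- (nu / mu)] lets one [ip W W] be absorbed on the left, so no division by the norm of
   [W] occurs. *)
have young := inner_young mO (sqintZ mO (- (nu / mu)) qP) qW.
rewrite (innerZl mO _ qP (sqintZ mO _ qP)) (innerZr mO _ qP qP) (innerZl mO _ qP qW) in young.
rewrite -/W.
have H : mu * ip W W <= - nu * ip (P t) W.
  by apply: balance_le bal; rewrite -QP mulr_ge0.
have {}H : ip W W <= - (nu / mu) * ip (P t) W.
  rewrite -(ler_pM2l mu_gt0); apply: le_trans H _.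
  by rewrite le_eqVlt; apply/orP; left; apply/eqP; field; rewrite lt0r_neq0.
exact: (absorb _ _ _ _ young H).
Qed.

Lemma derivative_cvg : directional_derivative S u h z.
Proof.
have cP : ip (P t) (P t) @[t --> 0^'+] --> 0.
  exact: (plast_quotient_cvg mO g_gt0 (mstrain (S u)) (qstrain z)).
have c0 (C : R) : C * ((nu / mu) ^+ 2 * ip (P t) (P t)) @[t --> 0^'+] --> 0.
  rewrite -[X in _ --> X](mulr0 C) -[X in _ --> C * X](mulr0 ((nu / mu) ^+ 2)).
  by apply: cvgM; [exact: cvg_cst|apply: cvgM => //; exact: cvg_cst].
have qf t : sqint (fun x => t^-1 *: (Sut t x - S u x) - z x).
  by have [w [<- _ _]] := remainder t; exact: qfld.
have qG t : sqint (fun x => t^-1 *: (grad (Sut t) x - grad (S u) x) - grad z x).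
  by have [w [_ <- _]] := remainder t; exact: qgrad.
apply: (cvg_H1_norm mO qf qG).2; split.
- apply: (@squeeze_cvgr _ _ _ _ (fun=> 0) _ _ _ _ _ (c0 (8 * M ^+ 2))); last exact: cvg_cst.
  near=> t; have t0 : 0 < t by near: t; exact: nbhs_right_gt.
  have [w [wf wg ws]] := remainder t; rewrite -/(Sut t) -wf inner_ge0/=.
  apply: le_trans (poincare mO vO OmegaM w) _; rewrite (korn mO vO).
  have := remainder_le t0 ws; rewrite mulrA (_ : 4 * M ^+ 2 * 2 = 8 * M ^+ 2); last by ring.
  by apply: ler_wpM2l; rewrite mulr_ge0// sqr_ge0.
- apply: (@squeeze_cvgr _ _ _ _ (fun=> 0) _ _ _ _ _ (c0 2)); last exact: cvg_cst.
  near=> t; have t0 : 0 < t by near: t; exact: nbhs_right_gt.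
  have [w [wf wg ws]] := remainder t; rewrite -/(Sut t) -wg inner_ge0/= (korn mO vO).
  by rewrite ler_pM2l//; exact: remainder_le.
Unshelve. all: by end_near. Qed.

End derivative.
End sensitivity.

Theorem theorem2p3 (R : realType) (N : nat) (Omega : set 'rV[R]_N)
    (mu nu g : R) (S : ('rV[R]_N -> 'rV[R]_N) -> Y Omega)
    (N23 : N = 2%N \/ N = 3%N)
    (Omega_dom : bounded_lipschitz_domain Omega)
    (mu_gt0 : 0 < mu) (nu_ge0 : 0 <= nu) (g_gt0 : 0 < g)
    (S_sol : forall u, square_integrable Omega u ->
       state_equation mu nu g u (S u)) :
  forall u h : 'rV[R]_N -> 'rV[R]_N,
    square_integrable Omega u -> square_integrable Omega h ->
    exists z : Y Omega,
      [/\ directional_derivative S u h z,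
          linearized_equation mu nu g (S u) h z &
          forall z' : Y Omega,
            linearized_equation mu nu g (S u) h z' -> H1_eq z' z].
Proof.
move=> u h qu qh; have [oO _ _ bO _] := Omega_dom.
have mO := open_measurable_rV oO; have vO := volume_bounded_finite mO bO.
have N0 : (0 < N)%N by case: N23 => ->.
(* The Poincare inequality requires one coordinate that is bounded on [Omega]. *)
pose j := Ordinal N0.
have [M OmegaM] : exists M, forall x, Omega x -> `|x 0 j| <= M.
  have [M [_ MP]] := bO; exists (M + 1) => x Ox.
  apply: le_trans (MP (M + 1) _ x Ox); last by rewrite ltrDl.
  by rewrite -[leRHS]/(mx_norm x) mx_normrE;
    exact: (le_bigmax _ (fun ij : 'I_1 * 'I_N => `|x ij.1 ij.2|) (0, j)).
have [z zP] := linearized_solution mO vO OmegaM mu_gt0 nu_ge0 g_gt0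
  (sqint_measurable (sqint_strain mO (S u))) qh (S u).
have z_sol : linearized_equation mu nu g (S u) h z by apply/linearized_equationP.
exists z; split => //; first exact: (derivative_cvg mO vO OmegaM mu_gt0 nu_ge0 g_gt0).
by move=> z'; exact: (linearized_equation_unique mO vO OmegaM mu_gt0 nu_ge0 g_gt0 z_sol).
Qed.
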